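(* Let $V$ be a commutative valuation domain with quotient field $F$, $K/F$ a finite Galois extension with group $G$, $S$ the integral closure of $V$ in $K$, $f:G\times G\to S\setminus\{0\}$ a normalized $2$-cocycle, and $N$ a maximal ideal of $S$. (1) The graph homomorphism $\psi_N:\mathrm{Gr}(f_N)\to\mathrm{Gr}(f^N)$ is an isomorphism if and only if there exists a set of right coset representatives $\sigma_1,\ldots,\sigma_r$ of $G^Z(S_N\mid F)$ in $G$ such that $f(\sigma_i,\sigma_i^{-1})\notin N$ for all $i$. When this happens, $\phi_N$ is a well-defined graph epimorphism and $\psi_N\circ\phi_N=c_N$. (2) If $\psi_N$ is a graph isomorphism and $M$ is another maximal ideal of $S$, then (a) the graphs $\mathrm{Gr}(f^M)$, $\mathrm{Gr}(f^N)$, $\mathrm{Gr}(f_M)$ and $\mathrm{Gr}(f_N)$ are all isomorphic, and (b) $\psi_M$ is also a graph isomorphism. In particular, if $K/F$ is tamely ramified and defectless and $A_f$ is primary, then $\psi_N$ is a graph isomorphism, $\psi_N\circ\phi_N=c_N$, and as $M$ ranges over all maximal ideals of $S$ the graphs $\mathrm{Gr}(f^M)$ and $\mathrm{Gr}(f_M)$ are all isomorphic to one another.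
   Context: $V$ has arbitrary Krull dimension. A normalized 2-cocycle satisfies $\sigma(f(\tau,\gamma))f(\sigma,\tau\gamma)=f(\sigma,\tau)f(\sigma\tau,\gamma)$, $f(1,\sigma)=f(\sigma,1)=1$; values need not be units. $A_f=\bigoplus_{\sigma\in G}Sx_\sigma$ with $(sx_\sigma)(tx_\tau)=s\,\sigma(t)f(\sigma,\tau)x_{\sigma\tau}$; it is primary if $J(A_f)$ is a maximal ideal. $H=\{\sigma\in G:f(\sigma,\sigma^{-1})\in U(S)\}$. $\mathrm{Gr}(f)$: partial order on the left coset space $G/H$, $\sigma H\le\tau H$ iff $f(\sigma,\sigma^{-1}\tau)\in U(S)$. For a maximal ideal $M$ of $S$: $\sigma H\le_M\tau H$ iff $f(\sigma,\sigma^{-1}\tau)\notin M$ is a well-defined preorder on $G/H$; $[\sigma]_M$ denotes the class of $\sigma H$ under the equivalence ''$\le_M$ both ways'', and $\mathrm{Gr}(f^M)$ is the induced partial order on these classes. $G^Z=G^Z(S_M\mid F)=\{\sigma\in G:\sigma(S_M)\subseteq S_M\}$; $f_M$ is the restriction of $f$ to $G^Z\times G^Z$; $H_M=\{\sigma\in G^Z: f(\sigma,\sigma^{-1})\notin M\}$ (a subgroup); $\mathrm{Gr}(f_M)$ is the partial order on $G^Z/H_M$ given by $\sigma H_M\le\tau H_M$ iff $f(\sigma,\sigma^{-1}\tau)\notin M$. Graph homomorphism = order-preserving map; isomorphism = bijection preserving and reflecting order; epimorphism = surjective homomorphism. $\psi_M:\mathrm{Gr}(f_M)\to\mathrm{Gr}(f^M)$,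 $\sigma H_M\mapsto[\sigma]_M$ ($\sigma\in G^Z$), is a well-defined injective graph homomorphism. $c_M:\mathrm{Gr}(f)\to\mathrm{Gr}(f^M)$, $\sigma H\mapsto[\sigma]_M$. $\phi_N:\mathrm{Gr}(f)\to\mathrm{Gr}(f_N)$, $\sigma H\mapsto dH_N$ where $d\in G^Z(S_N\mid F)$ satisfies $f(d^{-1}\sigma,\sigma^{-1}d)\notin N$. Tamely ramified and defectless: $e=[\Gamma_{S_M}:\Gamma_V]$, $r$ = number of maximal ideals of $S$, $[K:F]=e[\overline{S_M}:\overline V]r$, $\mathrm{char}\,\overline V\nmid e$, $\overline{S_M}/\overline V$ separable. *)

(* Defs.v *)
From HB Require Import structures.
From mathcomp Require Import all_boot all_order all_algebra all_fingroup.
From mathcomp Require Import all_field.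
From mathcomp Require Import boolp.
Set Implicit Arguments. Unset Strict Implicit. Unset Printing Implicit Defensive.
Import GRing.Theory.

Notation galT L := (gal_of (fullv : {vspace L})).
Local Open Scope ring_scope.

Section Graphs.
Variables (T T' : finType).

Definition graph_hom (vs : {set T}) (le : T -> T -> Prop)
    (vs' : {set T'}) (le' : T' -> T' -> Prop) (phi : T -> T') : Prop :=
  (forall X, X \in vs -> phi X \in vs') /\
  (forall X Y, X \in vs -> Y \in vs -> le X Y -> le' (phi X) (phi Y)).

Definition graph_epi vs le vs' le' phi : Prop :=
  graph_hom vs le vs' le' phi /\ (forall Y, Y \in vs' -> exists2 X, X \in vs & phi X = Y).

Definition graph_iso vs le vs' le' phi : Prop :=
  graph_epi vs le vs' le' phi /\
  {in vs &, injective phi} /\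
  (forall X Y, X \in vs -> Y \in vs -> le' (phi X) (phi Y) -> le X Y).

Definition graph_isomorphic vs le vs' le' : Prop :=
  exists phi, graph_iso vs le vs' le' phi.
End Graphs.

Section Setting.
Variables (F : fieldType) (L : splittingFieldType F).

(* V is a valuation domain with quotient field F (represented as a subring
   of F; the valuation property forces F = Frac V). *)
Definition valuation_domain (V : F -> Prop) : Prop :=
  [/\ V 0, V 1, (forall x y, V x -> V y -> V (x - y)),
      (forall x y, V x -> V y -> V (x * y)) &
      (forall x, x != 0 -> V x \/ V x^-1)].

Definition val_max (V : F -> Prop) (c : F) : Prop := V c /\ (c = 0 \/ ~ V c^-1).

Definition int_closure (V : F -> Prop) (x : L) : Prop :=
  exists p : {poly F}, [/\ p \is monic, (forall i, V p`_i) &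
                           root (map_poly (in_alg L) p) x].

Variable V : F -> Prop.
Notation S := (int_closure V).

Definition unitS (x : L) : Prop := [/\ S x, x != 0 & S x^-1].

Definition ideal_of_S (I : L -> Prop) : Prop :=
  [/\ (forall x, I x -> S x), I 0,
      (forall x y, I x -> I y -> I (x + y)) &
      (forall a x, S a -> I x -> I (a * x))].

Definition max_ideal (N : L -> Prop) : Prop :=
  [/\ ideal_of_S N, ~ N 1 &
      forall I, ideal_of_S I -> (forall x, N x -> I x) ->
                I 1 \/ (forall x, I x -> N x)].

Definition loc (N : L -> Prop) (x : L) : Prop :=
  exists a b, [/\ S a, S b, ~ N b & x = a / b].
Definition loc_max (N : L -> Prop) (x : L) : Prop :=
  exists a b, [/\ N a, S b, ~ N b & x = a / b].
Definition loc_unit (N : L -> Prop) (x : L) : Prop :=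
  [/\ loc N x, x != 0 & loc N x^-1].

(* The Galois group.  MathComp composes as (s * t) a = t (s a); the paper    *)
(* writes  st  for  s o t.  We therefore use  pmul s t := t * s  (= s o t).   *)
Local Notation gT := (gal_of (fullv : {vspace L})).
Definition pmul (s t : gT) : gT := (t * s)%g.

Definition lcos (H : {set gT}) (s : gT) : {set gT} := [set pmul s h | h in H].
Definition rcos (H : {set gT}) (s : gT) : {set gT} := [set pmul h s | h in H].

Variable f : gT -> gT -> L.

Definition normalized_2cocycle : Prop :=
  [/\ (forall s t : gT, S (f s t) /\ f s t != 0),
      (forall s t g : gT, s (f t g) * f s (pmul t g) = f s t * f (pmul s t) g),
      (forall s : gT, f 1%g s = 1) & (forall s : gT, f s 1%g = 1)].

Definition Hf : {set gT} := [set s | `[< unitS (f s s^-1%g) >]].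
Definition Gr_vs : {set {set gT}} := [set lcos Hf s | s in [set: gT]].
Definition Gr_le (X Y : {set gT}) : Prop :=
  exists s t, [/\ s \in X, t \in Y & unitS (f s (pmul s^-1%g t))].

Definition leM (M : L -> Prop) (s t : gT) : Prop := ~ M (f s (pmul s^-1%g t)).
Definition clsM (M : L -> Prop) (s : gT) : {set gT} :=
  [set t | `[< leM M s t /\ leM M t s >]].
Definition GrU_vs (M : L -> Prop) : {set {set gT}} :=
  [set clsM M s | s in [set: gT]].
Definition GrU_le (M : L -> Prop) (X Y : {set gT}) : Prop :=
  exists s t, [/\ s \in X, t \in Y & leM M s t].

Definition GZ (M : L -> Prop) : {set gT} :=
  [set s | `[< forall x, loc M x -> loc M ((s : gT) x) >]].
Definition HM (M : L -> Prop) : {set gT} :=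
  [set s in GZ M | `[< ~ M (f s s^-1%g) >]].
Definition GrL_vs (M : L -> Prop) : {set {set gT}} :=
  [set lcos (HM M) s | s in GZ M].
Definition GrL_le (M : L -> Prop) (X Y : {set gT}) : Prop :=
  exists s t, [/\ s \in X, t \in Y, s \in GZ M, t \in GZ M & leM M s t].

Definition psi (M : L -> Prop) (X : {set gT}) : {set gT} := clsM M (repr X).
Definition cmap (M : L -> Prop) (X : {set gT}) : {set gT} := clsM M (repr X).

(* phi is "the" map sH |-> d H_N with d in G^Z, f(d^-1 s, s^-1 d) \notin N:
   such d exist for every s, and phi takes the prescribed value for every
   choice of s and d (well-definedness). *)
Definition phi_spec (N : L -> Prop) (phi : {set gT} -> {set gT}) : Prop :=
  (forall s, exists2 d, d \in GZ N & ~ N (f (pmul d^-1%g s) (pmul s^-1%g d))) /\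
  (forall s d, d \in GZ N -> ~ N (f (pmul d^-1%g s) (pmul s^-1%g d)) ->
     phi (lcos Hf s) = lcos (HM N) d).

Definition rcos_transversal (N : L -> Prop) (T : {set gT}) : Prop :=
  forall s, #|rcos (GZ N) s :&: T| = 1%N.

(* x ~ y in L^x / (F^x U(S_M)) : same class in Gamma_{S_M} / Gamma_V *)
Definition vg_equiv (M : L -> Prop) (x y : L) : Prop :=
  exists c : F, exists2 u, c != 0 & loc_unit M u /\ x = c%:A * u * y.

Definition ram_index (M : L -> Prop) (e : nat) : Prop :=
  exists xs : 'I_e -> L,
    [/\ (forall i, xs i != 0),
        (forall i j, vg_equiv M (xs i) (xs j) -> i = j) &
        (forall y, y != 0 -> exists i, vg_equiv M y (xs i))].

(* [overline{S_M} : overline{V}] = n : a basis of the residue field of S_M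
   over that of V, given by lifts xs *)
Definition res_degree (M : L -> Prop) (n : nat) : Prop :=
  exists xs : 'I_n -> L,
    [/\ (forall i, loc M (xs i)),
        (forall a : 'I_n -> F, (forall i, V (a i)) ->
           loc_max M (\sum_i (a i)%:A * xs i) -> forall i, val_max V (a i)) &
        (forall y, loc M y -> exists a : 'I_n -> F, (forall i, V (a i)) /\
           loc_max M (y - \sum_i (a i)%:A * xs i))].

(* overline{S_M} / overline{V} separable: every residue class is a simple
   root of the reduction of some monic polynomial over V *)
Definition res_separable (M : L -> Prop) : Prop :=
  forall x, loc M x -> exists p : {poly F},
    [/\ p \is monic, (forall i, V p`_i),
        loc_max M (map_poly (in_alg L) p).[x] &
        ~ loc_max M (map_poly (in_alg L) p^`()).[x]].

Definition num_max_ideals (r : nat) : Prop :=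
  exists Ms : 'I_r -> (L -> Prop),
    [/\ (forall i, max_ideal (Ms i)),
        (forall i j, (forall x, Ms i x <-> Ms j x) -> i = j) &
        (forall M, max_ideal M -> exists i, forall x, M x <-> Ms i x)].

Definition tame_defectless : Prop :=
  exists M, max_ideal M /\ exists e n r,
    [/\ ram_index M e, res_degree M n, num_max_ideals r,
        \dim (fullv : {vspace L}) = (e * n * r)%N &
        ~ val_max V (e%:R : F) /\ res_separable M].

(* The crossed product A_f = (+)_s S x_s, elements as coefficient functions. *)
Definition Af (x : {ffun gT -> L}) : Prop := forall s, S (x s).
Definition af0 : {ffun gT -> L} := [ffun _ => 0].
Definition af1 : {ffun gT -> L} := [ffun s => if s == 1%g then 1 else 0].
Definition afadd (x y : {ffun gT -> L}) : {ffun gT -> L} := [ffun s => x s + y s].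
(* (a x_s)(b x_t) = a s(b) f(s,t) x_{st} *)
Definition afmul (x y : {ffun gT -> L}) : {ffun gT -> L} :=
  [ffun r => \sum_(s : gT) x s * (s : gT) (y (pmul s^-1%g r)) * f s (pmul s^-1%g r)].

Definition af_left_ideal (I : {ffun gT -> L} -> Prop) : Prop :=
  [/\ (forall x, I x -> Af x), I af0,
      (forall x y, I x -> I y -> I (afadd x y)) &
      (forall a x, Af a -> I x -> I (afmul a x))].
Definition af_ideal (I : {ffun gT -> L} -> Prop) : Prop :=
  af_left_ideal I /\ (forall a x, Af a -> I x -> I (afmul x a)).

Definition af_max_left_ideal I : Prop :=
  [/\ af_left_ideal I, ~ I af1 &
      forall J, af_left_ideal J -> (forall x, I x -> J x) ->
                J af1 \/ (forall x, J x -> I x)].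
Definition af_max_ideal I : Prop :=
  [/\ af_ideal I, ~ I af1 &
      forall J, af_ideal J -> (forall x, I x -> J x) ->
                J af1 \/ (forall x, J x -> I x)].

Definition jacobson (x : {ffun gT -> L}) : Prop :=
  Af x /\ forall I, af_max_left_ideal I -> I x.

Definition Af_primary : Prop := af_max_ideal jacobson.

End Setting.

Section Packaging.
Variables (F : fieldType) (L : splittingFieldType F) (V : F -> Prop)
          (f : galT L -> galT L -> L).

Definition psi_is_iso (M : L -> Prop) : Prop :=
  graph_iso (GrL_vs V f M) (GrL_le V f M) (GrU_vs f M) (GrU_le f M) (psi f M).

Definition phi_good (N : L -> Prop) : Prop :=
  exists phi : {set galT L} -> {set galT L},
    [/\ phi_spec V f N phi,
        graph_epi (Gr_vs V f) (Gr_le V f) (GrL_vs V f N) (GrL_le V f N) phi &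
        forall X, X \in Gr_vs V f -> psi f N (phi X) = cmap f N X].

Definition GrU_isomorphic (M M' : L -> Prop) : Prop :=
  graph_isomorphic (GrU_vs f M) (GrU_le f M) (GrU_vs f M') (GrU_le f M').
Definition GrL_isomorphic (M M' : L -> Prop) : Prop :=
  graph_isomorphic (GrL_vs V f M) (GrL_le V f M) (GrL_vs V f M') (GrL_le V f M').
Definition GrLU_isomorphic (M M' : L -> Prop) : Prop :=
  graph_isomorphic (GrL_vs V f M) (GrL_le V f M) (GrU_vs f M') (GrU_le f M').
End Packaging.

(* Main.v *)
Require Import Defs.
From HB Require Import structures.
From mathcomp Require Import all_boot all_order all_algebra all_fingroup.
From mathcomp Require Import all_field.
From mathcomp Require Import boolp ring.
From mathcomp Require ring_quotient classical_sets.
Import GRing.Theory.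
Local Open Scope ring_scope.
Set Implicit Arguments. Unset Strict Implicit. Unset Printing Implicit Defensive.

(* Write s ~ t when s H and t H are equivalent for <=_N.  The cocycle identity
   gives f(d, d^-1 s) f(s, s^-1 d) = d(f(d^-1 s, s^-1 d)), so for d in G^Z one has
   d ~ s iff t = d^-1 s satisfies f(t, t^-1) \notin N.  Since psi_N is always an
   embedding, it is an isomorphism iff every s is equivalent to some d in G^Z,
   that is, iff every right coset of G^Z contains such a t.  If moreover M = g^-1 N,
   then g can be chosen in its coset with f(g, g^-1) \notin N, and left
   multiplication by g carries <=_M to <=_N.

   In the tame case let M be the given maximal ideal, k = S/M, and let I be the
   inertia group.  Separability makes the residue field of V the fixed field of
   G^Z in k, so the theorems of Dedekind and Artin give |G^Z/I| = [k : V/m_V] and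
   hence |I| = e, a unit.  Therefore some c in S lies in all other maximal ideals
   while the sum of s(c) over G^Z is not in M.  An element j of J(A_f) is
   quasi-regular and integral over V, so right multiplication by j is nilpotent
   modulo M and its trace, the sum of s(j_1) over G, is in M; applied to multiples
   of j this forces j_1 in M.  So J(A_f) is contained in the largest ideal whose
   elements have their coefficient at 1 in M, and equals it when A_f is primary.
   If no t in G^Z s had f(t, t^-1) \notin M, that ideal would contain the elements
   of S that lie in every maximal ideal except s^-1 M. *)

(** * Subrings, residue fields and linear algebra *)

Section SubringType.
Variables (K : comNzRingType) (P : K -> Prop).
Hypotheses (P1 : P 1) (PB : forall x y, P x -> P y -> P (x - y))
           (PM : forall x y, P x -> P y -> P (x * y)).
Definition subr_pred : {pred K} := fun x => `[< P x >].
Fact subr_closed : subring_closed subr_pred.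
Proof.
split=> [|x y /asboolP Px /asboolP Py|x y /asboolP Px /asboolP Py];
  by apply/asboolP; auto.
Qed.
HB.instance Definition _ := GRing.isSubringClosed.Build K subr_pred subr_closed.
Record subr_type := SubrType { subr_val : K; subr_valP : subr_val \in subr_pred }.
HB.instance Definition _ := [isSub of subr_type for subr_val].
HB.instance Definition _ := [Choice of subr_type by <:].
HB.instance Definition _ := [SubChoice_isSubComNzRing of subr_type by <:].

(** Prop-valued subrings of [F] and [L] become ring types here, so that the library results on
    integrality, matrices and polynomials apply to them. *)
Lemma subring_type : exists (R : comNzRingType) (i : {rmorphism R -> K}),
  injective i /\ forall x, P x <-> exists r, i r = x.
Proof.
exists subr_type, (\val : {rmorphism subr_type -> K}); split; first exact: val_inj.
move=> x; split=> [Px | [r <-]]; last exact/asboolP/(valP r).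
have Px' : x \in subr_pred by apply/asboolP.
by exists (SubrType Px').
Qed.
End SubringType.

Section SubfieldType.
Variables (K : fieldType) (P : K -> Prop).
Hypotheses (P1 : P 1) (PB : forall x y, P x -> P y -> P (x - y))
           (PM : forall x y, P x -> P y -> P (x / y)).
Definition subf_pred : {pred K} := fun x => `[< P x >].
Fact subf_closed : divring_closed subf_pred.
Proof.
split=> [|x y /asboolP Px /asboolP Py|x y /asboolP Px /asboolP Py];
  by apply/asboolP; auto.
Qed.
HB.instance Definition _ := GRing.isDivringClosed.Build K subf_pred subf_closed.
Record subf_type := SubfType { subf_val : K; subf_valP : subf_val \in subf_pred }.
HB.instance Definition _ := [isSub of subf_type for subf_val].
HB.instance Definition _ := [Choice of subf_type by <:].
HB.instance Definition _ := [SubChoice_isSubComUnitRing of subf_type by <:].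
HB.instance Definition _ := [SubComUnitRing_isSubIntegralDomain of subf_type by <:].
HB.instance Definition _ := [SubIntegralDomain_isSubField of subf_type by <:].

Lemma subfield_type : exists (R : fieldType) (i : {rmorphism R -> K}),
  forall x, P x <-> exists r, i r = x.
Proof.
exists subf_type, (\val : {rmorphism subf_type -> K}).
move=> x; split=> [Px | [r <-]]; last exact/asboolP/(valP r).
have Px' : x \in subf_pred by apply/asboolP.
by exists (SubfType Px').
Qed.
End SubfieldType.

Section ResidueField.
Variables (R : comNzRingType) (I : R -> Prop).
Hypotheses (I0 : I 0) (I1 : ~ I 1) (ID : forall x y, I x -> I y -> I (x + y))
  (IM : forall a x, I x -> I (a * x))
  (Imax : forall x, ~ I x -> exists y, I (1 - y * x)).
Import ring_quotient.
Local Open Scope quotient_scope.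
Definition id_pred : {pred R} := fun x => `[< I x >].
Fact id_closed : idealr_closed id_pred.
Proof.
split; [exact/asboolP| exact/asboolP |].
by move=> a x y /asboolP Px /asboolP Py; apply/asboolP/ID => //; apply/IM.
Qed.
HB.instance Definition _ := isIdealr.Build R id_pred id_closed.
Definition resf : Type := {ideal_quot id_pred}.
HB.instance Definition _ := GRing.ComNzRing.on resf.

(** Inverses modulo [I] are chosen classically; the second clause fixes the value 0 at 0, which the
    field structure demands. *)
Lemma resf_inv_exists (x : resf) : exists y : resf, (x != 0 -> y * x = 1) /\ (x = 0 -> y = 0).
Proof.
have [x0|x0] := asboolP (x = 0); first by exists 0; rewrite x0 eqxx.
rewrite -[x]generic_quotient.reprK in x0 *.
have [|y Hy] := @Imax (generic_quotient.repr x).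
  move=> Ix; apply: x0; rewrite -(rmorph0 (\pi_resf : {rmorphism R -> resf})).
  by apply/eqP; rewrite -Quotient.idealrBE subr0; apply/asboolP.
exists (\pi_resf y); split=> // _; rewrite -(rmorphM (\pi_resf : {rmorphism R -> resf})).
rewrite -(rmorph1 (\pi_resf : {rmorphism R -> resf})).
apply/eqP; rewrite eq_sym -Quotient.idealrBE; exact/asboolP.
Qed.
Definition resf_inv (x : resf) : resf := projT1 (cid (resf_inv_exists x)).
Fact resf_mulVx (x : resf) : x != 0 -> resf_inv x * x = 1.
Proof. by rewrite /resf_inv; case: cid => y [/= + _]. Qed.
Fact resf_inv0 : resf_inv 0 = 0.
Proof. by rewrite /resf_inv; case: cid => y [/= _ ->]. Qed.
HB.instance Definition _ := GRing.ComNzRing_isField.Build resf resf_mulVx resf_inv0.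

Lemma residue_field : exists (k : fieldType) (p : {rmorphism R -> k}),
  (forall x, I x <-> p x = 0) /\ (forall y, exists x, p x = y).
Proof.
exists resf, (\pi_resf : {rmorphism R -> resf}); split=> [x|y]; last first.
  by exists (generic_quotient.repr y); exact: generic_quotient.reprK.
rewrite -[X in _ = X](rmorph0 (\pi_resf : {rmorphism R -> resf})).
split=> [Ix | /eqP]; last by rewrite -Quotient.idealrBE subr0 => /asboolP.
by apply/eqP; rewrite -Quotient.idealrBE subr0; apply/asboolP.
Qed.
End ResidueField.

Section MorphismLift.
Variables (A B C : comNzRingType) (i : {rmorphism B -> C}) (g : {rmorphism A -> C}).
Hypotheses (inj_i : injective i) (im_g : forall a, exists b, i b = g a).
Definition rmorph_lift_fun a := projT1 (cid (im_g a)).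
Fact rmorph_liftK a : i (rmorph_lift_fun a) = g a.
Proof. by rewrite /rmorph_lift_fun; case: cid. Qed.
Fact rmorph_lift_zmod : zmod_morphism rmorph_lift_fun.
Proof. by move=> a b; apply: inj_i; rewrite rmorphB !rmorph_liftK rmorphB. Qed.
Fact rmorph_lift_monoid : monoid_morphism rmorph_lift_fun.
Proof.
split=> [|a b]; apply: inj_i; first by rewrite rmorph_liftK !rmorph1.
by rewrite rmorphM !rmorph_liftK rmorphM.
Qed.
HB.instance Definition _ := GRing.isZmodMorphism.Build A B rmorph_lift_fun rmorph_lift_zmod.
HB.instance Definition _ := GRing.isMonoidMorphism.Build A B rmorph_lift_fun rmorph_lift_monoid.

Lemma rmorph_lift : exists h : {rmorphism A -> B}, forall a, i (h a) = g a.
Proof. exists (rmorph_lift_fun : {rmorphism A -> B}); exact: rmorph_liftK. Qed.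
End MorphismLift.

(** Dedekind, for ring morphisms into a field: subtracting [chi t a] times a relation from its
    translate by [a] removes the coefficient at [t] and keeps the one at [s]. A relation of minimal
    support thus has one term, and evaluation at 1 rules it out. *)
Lemma characters_independent (R : comNzRingType) (k : fieldType) (T : finType)
    (chi : T -> {rmorphism R -> k}) (c : T -> k) :
  (forall s t, chi s =1 chi t -> s = t) ->
  (forall r, \sum_t c t * chi t r = 0) -> forall t, c t = 0.
Proof.
move=> chi_inj; have [m] := ubnP #|[set t | c t != 0]|.
elim: m c => [|m IH] c; first by rewrite ltn0.
move=> lem sum0 t; apply/eqP/negPn/negP => ct.
have [[s st cs] | only_t] := pselect (exists2 s, s != t & c s != 0); last first.
  move: (sum0 1); rewrite (bigD1 t) //= rmorph1 mulr1 big1 => [/eqP|s st].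
    by rewrite addr0 (negPf ct).
  have [->|cs] := eqVneq (c s) 0; first by rewrite mul0r.
  by exfalso; apply: only_t; exists s.
have [a neq_a] : exists a, chi s a != chi t a.
  apply: contrapT => eq_st; move/eqP: st => st; apply: st; apply: chi_inj => a.
  by apply/eqP/negPn/negP => ?; apply: eq_st; exists a.
pose c' u := c u * (chi u a - chi t a).
suff /eqP : c' s = 0 by rewrite mulf_eq0 subr_eq0 (negPf cs) (negPf neq_a).
apply: IH.
  rewrite ltnS in lem; apply: leq_trans lem; apply: proper_card; apply/properP; split.
    by apply/subsetP => u; rewrite !inE mulf_eq0 negb_or => /andP[].
  by exists t; rewrite !inE // /c' subrr mulr0 eqxx.
move=> r; transitivity (\sum_u c u * chi u (a * r) - chi t a * \sum_u c u * chi u r).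
  rewrite mulr_sumr -sumrB; apply: eq_bigr => u _.
  by rewrite rmorphM /c' mulrBr mulrBl mulrA [chi t a * _]mulrCA mulrA.
by rewrite !sum0 mulr0 subrr.
Qed.

(** Since [A ^+ i = 0], a geometric sum shows that X - A divides the scalar matrix X^i. By
    determinants the characteristic polynomial divides a power of X, hence is one, and the
    coefficient that is minus the trace vanishes. *)
Lemma nilpotent_trace (k : fieldType) n (A : 'M[k]_n.+1) i : A ^+ i = 0 -> \tr A = 0.
Proof.
move=> Ai0.
have: char_poly A %| ('X^i) ^+ n.+1.
  have E : (char_poly_mx A) * (\sum_(j < i) ('X%:M) ^+ (i.-1 - j) * (map_mx polyC A) ^+ j) = ('X^i)%:M.
    rewrite /char_poly_mx -subrXX_comm; last by apply: comm_mx_sym; apply/comm_mx_scalar.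
    by rewrite -[map_mx _ _ ^+ _]rmorphXn Ai0 /= map_mx0 subr0 -rmorphXn.
  have := congr1 determinant E; rewrite det_scalar => <-.
  by rewrite -mulmxE det_mulmx; apply: dvdp_mulIl.
rewrite -exprM -['X]subr0 => /dvdp_exp_XsubCP [d _ ].
rewrite subr0 => eqp.
have E: char_poly A = 'X^d by apply/eqP; rewrite -eqp_monic // ?char_poly_monic ?monicXn.
have dn : d = n.+1.
  by have := size_char_poly A; rewrite E size_polyXn => -[].
have := char_poly_trace A (ltn0Sn n); rewrite E dn /= coefXn.
rewrite (_ : (n == n.+1) = false); last by rewrite ltn_eqF.
by move/esym/eqP; rewrite oppr_eq0 => /eqP.
Qed.

Lemma poly_lift (A B : nzRingType) (j : {rmorphism A -> B}) (P : {poly B}) :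
  (forall i, exists a, j a = P`_i) -> exists q, map_poly j q = P.
Proof.
move=> /choice[g gP]; exists (\poly_(i < size P) g i); apply/polyP => i.
rewrite coef_map coef_poly; case: ltnP => [_|szP]; first exact: gP.
by rewrite raddf0 nth_default.
Qed.

Lemma row_free_leq (k : fieldType) m n (X : 'M[k]_(m, n)) :
  (forall v : 'rV_m, v *m X = 0 -> v = 0) -> (m <= n)%N.
Proof.
move=> Xinj; have /eqP : kermx X = 0.
  by apply/row_matrixP => i; rewrite row0; apply: Xinj; rewrite -row_mul mulmx_ker row0.
by rewrite kermx_eq0 => /eqP <-; apply: rank_leq_col.
Qed.

(* X - z is the gcd of the two polynomials. *)
Lemma simple_root_descent (k0 k : fieldType) (j : {rmorphism k0 -> k})
    (P : {poly k}) (z : k) a :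
  (forall i, exists c, j c = P`_i) -> (0 < a)%N ->
  (forall i, exists c, j c = (('X - z%:P) ^+ a)`_i) ->
  root P z -> ~~ root P^`() z -> exists c, j c = z.
Proof.
move=> /poly_lift[p <-] a0 /poly_lift[g gE] Pz P'z.
have := dvdp_gcdr (map_poly j p) (map_poly j g).
rewrite gE => /dvdp_exp_XsubCP[c _ dE].
have rd : root (gcdp (map_poly j p) (('X - z%:P) ^+ a)) z.
  by rewrite root_gcd Pz rootE horner_exp hornerXsubC subrr expf_eq0 a0 eqxx.
have c1 : c = 1%N.
  case: c dE => [|[|c]] dE //.
    by move: rd; rewrite (eqp_root dE) rootE hornerC oner_eq0.
  have : ('X - z%:P) ^+ 2 %| map_poly j p.
    apply: dvdp_trans (dvdp_gcdl _ (('X - z%:P) ^+ a)); rewrite (eqp_dvdr _ dE).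
    by rewrite dvdp_exp2l.
  case/dvdpP => u pE; case/negP: P'z; rewrite pE expr2 mulrA derivM rootE.
  by rewrite hornerD !hornerM hornerXsubC subrr !(mulr0, mul0r) addr0.
move: dE; rewrite c1 expr1 -gE -gcdp_map => /eqpP[[u v] /= /andP[u0 v0] E].
have E0 := congr1 (fun q : {poly k} => q`_0) E; have E1 := congr1 (fun q : {poly k} => q`_1) E.
rewrite /= !coefZ !coef_map coefB coefX coefC /= sub0r in E0.
rewrite /= !coefZ !coef_map coefB coefX coefC /= subr0 mulr1 in E1.
set d := gcdp p g in E0 E1.
have d1 : j d`_1 != 0 by apply: contra_neq v0 => d10; rewrite -E1 d10 mulr0.
exists (- d`_0 / d`_1); rewrite fmorph_div rmorphN; apply: (mulIf d1).
rewrite divfK //; apply: (mulfI u0); rewrite mulrN E0 mulrN opprK mulrCA E1 mulrC.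
by [].
Qed.

(** * The residue action of a decomposition group: inertia, Dedekind and Artin *)

Section Inertia.
Variables (R : comNzRingType) (k : fieldType) (p : {rmorphism R -> k}) (gT : finGroupType).
Variables (h : gT -> {rmorphism R -> R}) (D : {group gT}) (K0 : k -> Prop).
Hypothesis p_surj : forall y, exists r, p r = y.
Hypothesis h1 : forall r, h 1%g r = r.
Hypothesis hM : forall a s r, h (a * s)%g r = h s (h a r).
Hypothesis kerD : forall s r, s \in D -> p r = 0 -> p (h s r) = 0.
Hypothesis fixD : forall r, (forall s, s \in D -> p (h s r) = p r) -> K0 (p r).
Hypothesis K0_lift : forall z, K0 z -> exists r, p r = z /\ forall s, h s r = r.
Variables (n : nat) (w : 'I_n -> R).
Hypothesis w_free : forall z : 'I_n -> k, (forall i, K0 (z i)) ->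
  \sum_i z i * p (w i) = 0 -> forall i, z i = 0.
Hypothesis w_span : forall y, exists z : 'I_n -> k, (forall i, K0 (z i)) /\
  y = \sum_i z i * p (w i).

Lemma eq_mod_conj s r r' : s \in D -> p r = p r' -> p (h s r) = p (h s r').
Proof.
move=> sD pr; apply/eqP; rewrite -subr_eq0 -rmorphB -rmorphB /=; apply/eqP/kerD => //.
by rewrite rmorphB pr subrr.
Qed.

(* Artin: a relation of minimal support, normalized to have a coefficient 1,
   is fixed by D, hence has coefficients in K0. *)
Lemma columns_free (z : 'I_n -> k) :
  (forall s, s \in D -> \sum_i z i * p (h s (w i)) = 0) -> forall i, z i = 0.
Proof.
have [m] := ubnP #|[set i | z i != 0]|.
elim: m z => [|m IH] z; first by rewrite ltn0.
rewrite ltnS => lem rel t; apply/eqP/negPn/negP => zt.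
have /choice[zeta0 zeta0P] : forall i, exists r, p r = z i / z t by move=> i; apply: p_surj.
(* The coefficient at [t] is set to 1 itself, so that it is visibly fixed and drops out of the
   difference below. *)
pose zeta i := if i == t then 1 else zeta0 i.
have zetaP i : p (zeta i) = z i / z t.
  by rewrite /zeta; case: eqP => [->|_]; rewrite ?rmorph1 ?divff.
have zetat : zeta t = 1 by rewrite /zeta eqxx.
have rel' s : s \in D -> p (\sum_i zeta i * h s (w i)) = 0.
  move=> sD; transitivity ((\sum_i z i * p (h s (w i))) / z t); last by rewrite rel // mul0r.
  rewrite rmorph_sum mulr_suml.
  by apply: eq_bigr => i _; rewrite rmorphM zetaP mulrAC.
have fixz i : K0 (p (zeta i)).
  apply: fixD => s sD; apply/esym/eqP; rewrite -subr_eq0.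
  suff /(_ i) -> : forall i, p (zeta i) - p (h s (zeta i)) = 0 by [].
  apply: IH.
    apply: leq_trans lem; apply: proper_card; apply/properP; split.
      apply/subsetP => u; rewrite !inE; apply: contra_neq => zu.
      have pz0 : p (zeta u) = 0 by rewrite zetaP zu mul0r.
      by rewrite pz0 (kerD sD pz0) subrr.
    by exists t; rewrite !inE // zetat !rmorph1 subrr eqxx.
  (* Conjugating the relation for [b * s^-1] by [s] gives one for [b] with conjugated coefficients;
     subtracting it from the original relation for [b] leaves the differences. *)
  move=> b bD; have bsD : (b * s^-1)%g \in D by rewrite groupM ?groupV.
  have := kerD sD (rel' _ bsD); rewrite rmorph_sum rmorph_sum /=.
  have := rel' _ bD; rewrite rmorph_sum /= => E1 E2.
  transitivity (\sum_i p (zeta i * h b (w i)) - \sum_i p (h s (zeta i * h (b * s^-1)%g (w i)))).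
    rewrite -sumrB; apply: eq_bigr => u _; rewrite !rmorphM -hM -mulgA mulVg mulg1.
    by rewrite mulrBl.
  by rewrite E1 E2 subrr.
have E : \sum_i p (zeta i) * p (w i) = 0.
  rewrite -[RHS](rel' _ (group1 D)) rmorph_sum.
  by apply: eq_bigr => i _; rewrite rmorphM h1.
by have := w_free fixz E t; rewrite zetat rmorph1 => /eqP; rewrite oner_eq0.
Qed.

(** [D] is partitioned by the induced maps to [k], and [m] is the size of the class of 1, the
    inertia group. The number of classes is [n]: the characters are independent by Dedekind, the
    columns by [columns_free]. The sum over [D] is [m] times the sum of the distinct characters,
    which independence keeps from vanishing. *)
Lemma inertia_index : exists m, #|D| = (n * m)%N /\
  (m%:R != 0 :> k -> exists r, \sum_(s in D) p (h s r) != 0).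
Proof.
pose chi s : {rmorphism R -> k} := p \o h s.
pose cl s := [set t in D | `[< chi t =1 chi s >]].
pose I := cl 1%g; pose Cl := [set cl s | s in D].
have cl_self s : s \in D -> s \in cl s by move=> sD; rewrite inE sD; apply/asboolP.
have clP s t : s \in D -> t \in D -> reflect (chi t =1 chi s) (cl t == cl s).
  move=> sD tD; apply: (iffP eqP) => [E|E].
    by have := cl_self _ tD; rewrite E inE => /andP[_ /asboolP].
  apply/setP => u; rewrite !inE; congr (_ && _); apply/asboolP/asboolP => H r.
    by rewrite H E.
  by rewrite H E.
have cardcl s : s \in D -> #|cl s| = #|I|.
  move=> sD; rewrite -(card_rcoset I s); apply: eq_card => t.
  rewrite mem_rcoset !inE groupMr ?groupV //; congr (_ && _).
  apply/asboolP/asboolP => H r; rewrite /chi /=.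
    rewrite hM h1 (eq_mod_conj (s := s^-1%g) (r' := h s r)) ?groupV //; last exact: H.
    by rewrite -hM mulgV h1.
  have := eq_mod_conj sD (H r); rewrite /chi /= h1 -!hM => <-.
  by rewrite mulgKV.
have nI : cl 1%g \in Cl by apply: imset_f.
pose tau (j : 'I_#|Cl|) := repr (enum_val j).
have tauP j : tau j \in D /\ cl (tau j) = enum_val j.
  have /imsetP[s sD E] := enum_valP j.
  have : tau j \in cl s by rewrite /tau E; apply: mem_repr (cl_self s sD).
  rewrite inE => /andP[tD /asboolP H]; split=> //; rewrite E; exact/eqP/clP.
have tau_ex s : s \in D -> exists j, chi s =1 chi (tau j).
  move=> sD; have sC : cl s \in Cl by apply: imset_f.
  exists (enum_rank_in sC (cl s)); apply/clP => //; first by case: (tauP (enum_rank_in sC (cl s))).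
  by case: (tauP (enum_rank_in sC (cl s))) => _ ->; rewrite enum_rankK_in.
have fib j s : (s \in D) && (cl s == enum_val j) = (s \in cl (tau j)).
  have [tD <-] := tauP j; rewrite [RHS]inE; apply: andb_id2l => sD.
  by apply/clP/asboolP.
have sum_chi r : \sum_(s in D) chi s r = #|I|%:R * \sum_j chi (tau j) r.
  rewrite (partition_big_imset cl) /= -/Cl big_enum_val mulr_sumr.
  apply: eq_bigr => j _; have [tD tE] := tauP j.
  rewrite -(cardcl _ tD) -sum1_card natr_sum mulr_suml.
  apply: eq_big => [s|s]; first exact: fib.
  by rewrite fib inE mul1r => /andP[_ /asboolP H]; apply: H.
have cardD : #|D| = (#|Cl| * #|I|)%N.
  rewrite -sum1_card (partition_big_imset cl) /= -/Cl big_enum_val.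
  transitivity (\sum_(j < #|Cl|) #|I|); last by rewrite sum_nat_const card_ord.
  apply: eq_bigr => j _; have [tD _] := tauP j.
  by rewrite (eq_bigl _ _ (fib j)) sum1_card cardcl.
have tau_inj i j : chi (tau i) =1 chi (tau j) -> i = j.
  move=> E; apply: enum_val_inj; have [iD <-] := tauP i; have [jD <-] := tauP j.
  exact/eqP/clP.
have chi_ind := characters_independent tau_inj.
have kerchi j r r' : p r = p r' -> chi (tau j) r = chi (tau j) r'.
  by have [tD _] := tauP j; apply: eq_mod_conj.
pose X := \matrix_(j < #|Cl|, i < n) chi (tau j) (w i).
have Cln : #|Cl| = n.
  apply/eqP; rewrite eqn_leq; apply/andP; split.
    apply: (@row_free_leq _ _ _ X) => v vX; apply/rowP => j; rewrite mxE.
    (* A relation on the basis extends to all of [R], because coefficients in [K0] lift to elements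
       that every [h s] fixes. *)
    apply: (chi_ind (fun j => v 0 j)) => r.
    have [z [Kz pr]] := w_span (p r).
    have /choice[rho rhoP] : forall i, exists r, p r = z i /\ forall s, h s r = r.
      by move=> i; apply: K0_lift.
    have E t : chi (tau t) r = \sum_i z i * chi (tau t) (w i).
      rewrite (kerchi _ _ (\sum_i rho i * w i)); last first.
        by rewrite pr rmorph_sum; apply: eq_bigr => i _; rewrite rmorphM (rhoP i).1.
      rewrite /= rmorph_sum rmorph_sum /=; apply: eq_bigr => i _.
      by rewrite !rmorphM (rhoP i).2 (rhoP i).1.
    under eq_bigr => t _ do rewrite E mulr_sumr.
    rewrite exchange_big /=; apply: big1 => i _.
    have := congr1 (fun M : 'rV_n => M 0 i) vX; rewrite !mxE => vXi.
    rewrite -[RHS](mulr0 (z i)) -[X in _ = _ * X]vXi mulr_sumr.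
    by apply: eq_bigr => t _; rewrite mxE mulrCA.
  apply: (@row_free_leq _ _ _ X^T) => v vX; apply/rowP => i; rewrite mxE.
  apply: (columns_free (z := fun i => v 0 i)) => s /tau_ex[j sj].
  have := congr1 (fun M : 'rV_#|Cl| => M 0 j) vX; rewrite !mxE => vXj.
  by rewrite -[RHS]vXj; apply: eq_bigr => u _; rewrite !mxE -sj.
exists #|I|; split=> [|mI]; first by rewrite cardD Cln.
apply: contrapT => none; have [j _] := tau_ex _ (group1 D).
(* Otherwise the distinct characters would satisfy a relation with all coefficients 1. *)
have : (1 : k) = 0.
  apply: (chi_ind (fun=> 1) _ j) => r; apply: (mulfI mI); rewrite mulr0.
  under eq_bigr => t _ do rewrite mul1r.
  by rewrite -sum_chi; apply/eqP/negPn/negP => H; apply: none; exists r.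
by move/eqP; rewrite oner_eq0.
Qed.
End Inertia.

(** * Maximal ideals of the integral closure *)

Section IntegralClosure.
Variables (F : fieldType) (L : splittingFieldType F) (V : F -> Prop).
Hypothesis hV : valuation_domain V.
Local Notation S := (int_closure (L := L) V).
Local Notation gT := (galT L).

Lemma vring0 : V 0. Proof. by case: hV. Qed.
Lemma vring1 : V 1. Proof. by case: hV. Qed.
Lemma vringB x y : V x -> V y -> V (x - y). Proof. by case: hV => _ _ H _ _; apply: H. Qed.
Lemma vringM x y : V x -> V y -> V (x * y). Proof. by case: hV => _ _ _ H _; apply: H. Qed.
Lemma vringN x : V x -> V (- x).
Proof. by rewrite -sub0r; apply/vringB/vring0. Qed.
Lemma vringD x y : V x -> V y -> V (x + y).
Proof. by move=> Vx Vy; rewrite -[y]opprK; apply: vringB => //; apply: vringN. Qed.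
Lemma vring_sum (I : Type) (r : seq I) (P : pred I) (E : I -> F) :
  (forall i, P i -> V (E i)) -> V (\sum_(i <- r | P i) E i).
Proof. by move=> VE; elim/big_ind: _ => //; [exact: vring0 | exact: vringD]. Qed.
Lemma vring_nat n : V n%:R.
Proof.
by elim: n => [|n IH]; [exact: vring0 | rewrite -addn1 natrD; apply/vringD/vring1].
Qed.
Lemma vringX x n : V x -> V (x ^+ n).
Proof. by move=> Vx; elim: n => [|n IH]; [exact: vring1 | rewrite exprS; apply: vringM]. Qed.

(** [V] becomes a ring type [W] and [int_closure] becomes [integralOver], from which the ring
    closure properties of [S] are taken. *)
Lemma int_closureE : exists (W : comNzRingType) (i : {rmorphism W -> F}),
  (forall c, V c <-> exists r, i r = c) /\
  (forall x, S x <-> integralOver (in_alg L \o i) x).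
Proof.
have [W [i [inj_i iP]]] := subring_type vring1 vringB vringM.
exists W, i; split=> // x; split=> [[p [p_mon Vp px0]] | [p p_mon px0]].
  (* [g] is a section of [i] on [V], with value 0 elsewhere; [g 0 = 0] is what allows it to be
     applied coefficientwise. *)
  pose g c := if pselect (exists r, i r = c) is left h then projT1 (cid h) else 0.
  have gK c : V c -> i (g c) = c.
    by rewrite iP /g => Vc; case: pselect => // h; case: cid.
  have g0 : g 0 = 0 by have := gK _ vring0; rewrite -[X in _ = X](rmorph0 i) => /inj_i.
  have gp : map_poly i (map_poly g p) = p.
    by apply/polyP => j; rewrite coef_map (coef_map_id0 _ _ g0) /= gK.
  exists (map_poly g p); last by rewrite -gp -map_poly_comp in px0.
  rewrite monicE; apply/eqP; apply: (inj_i); rewrite rmorph1.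
  by rewrite -[LHS](lead_coef_map_inj inj_i (rmorph0 i)) gp (monicP p_mon).
exists (map_poly i p); split; first exact: monic_map.
  by move=> j; rewrite coef_map; apply/iP; eexists.
by rewrite -map_poly_comp.
Qed.

Lemma intS_alg c : V c -> S c%:A.
Proof.
move=> Vc; exists ('X - c%:P); split; first exact: monicXsubC.
  move=> i; rewrite coefB coefX coefC; apply: vringB; case: eqP => _ //=;
    by [exact: vring1 | exact: vring0].
by rewrite rmorphB /= map_polyX map_polyC /= root_XsubC.
Qed.
Lemma intS0 : S 0. Proof. by rewrite -(scale0r 1); exact/intS_alg/vring0. Qed.
Lemma intS1 : S 1. Proof. by rewrite -(scale1r 1); exact/intS_alg/vring1. Qed.
Lemma intSB x y : S x -> S y -> S (x - y).
Proof. by have [W [i [_ iS]]] := int_closureE; rewrite !iS; apply: integral_sub. Qed.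
Lemma intSM x y : S x -> S y -> S (x * y).
Proof. by have [W [i [_ iS]]] := int_closureE; rewrite !iS; apply: integral_mul. Qed.
Lemma intSN x : S x -> S (- x).
Proof. by rewrite -sub0r; apply/intSB/intS0. Qed.
Lemma intSD x y : S x -> S y -> S (x + y).
Proof. by move=> Sx Sy; rewrite -[y]opprK; apply: intSB => //; apply: intSN. Qed.
Lemma intS_sum (I : Type) (r : seq I) (P : pred I) (E : I -> L) :
  (forall i, P i -> S (E i)) -> S (\sum_(i <- r | P i) E i).
Proof. by move=> SE; elim/big_ind: _ => //; [exact: intS0 | exact: intSD]. Qed.
Lemma intS_prod (I : Type) (r : seq I) (P : pred I) (E : I -> L) :
  (forall i, P i -> S (E i)) -> S (\prod_(i <- r | P i) E i).
Proof. by move=> SE; elim/big_ind: _ => //; [exact: intS1 | exact: intSM]. Qed.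

Lemma intS_gal (s : gT) x : S x -> S (s x).
Proof.
case=> p [p_mon Vp px0]; exists p; split=> //; apply/eqP.
have <- : map_poly s (map_poly (in_alg L) p) = map_poly (in_alg L) p.
  by rewrite -map_poly_comp; apply: eq_map_poly => c /=; rewrite rmorph_alg.
by rewrite horner_map (eqP px0) rmorph0.
Qed.

(* A valuation ring is integrally closed: if c is not in V then 1/c is, and an
   integral equation for c, divided by a power of c, puts c in V. *)
Lemma intS_base c : S c%:A -> V c.
Proof.
case=> p [p_mon Vp /eqP]; rewrite horner_map -[RHS](scale0r 1) => pc0.
have {}pc0 : p.[c] = 0 by apply: (fmorph_inj (in_alg L)).
have [->|c0] := eqVneq c 0; first exact: vring0.
have [_ _ _ _ /(_ c c0)[//|Vc]] := hV.
have [n sz_p] : exists n, size p = n.+1.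
  by exists (size p).-1; rewrite prednK // size_poly_gt0 monic_neq0.
case: n sz_p => [|n] sz_p.
  move: pc0; rewrite (size1_polyC (eq_leq sz_p)) hornerC => p00.
  by have := monicP p_mon; rewrite lead_coefE sz_p /= p00 => /esym/eqP; rewrite oner_eq0.
have lc : p`_n.+1 = 1 by have := monicP p_mon; rewrite lead_coefE sz_p.
move: pc0; rewrite horner_coef sz_p big_ord_recr /= lc mul1r => /eqP.
rewrite addrC addr_eq0 => /eqP cn.
have -> : c = - \sum_(i < n.+1) p`_i * c^-1 ^+ (n - i).
  rewrite -[LHS](mulfK (expf_neq0 n c0)) -exprS cn mulNr mulr_suml.
  congr (- _); apply: eq_bigr => i _; rewrite -mulrA; congr (_ * _).
  have in_ : (i <= n)%N by rewrite -ltnS.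
  have -> : c ^+ n = c ^+ (n - i) * c ^+ i by rewrite -exprD subnK.
  by rewrite invfM mulrCA mulfV ?expf_neq0 // mulr1 exprVn.
by apply/vringN/vring_sum => i _; apply: vringM => //; apply: vringX.
Qed.

Hypothesis galL : galois 1%VS (fullv : {vspace L}).

Lemma galM_full (s t : gT) x : (s * t)%g x = t (s x).
Proof. by rewrite galM ?memvf. Qed.

Lemma gal_fixed_base x : (forall s : gT, s x = x) -> exists c : F, x = c%:A.
Proof.
move=> fx; have : x \in fixedField 'Gal(fullv / 1%VS)%g by apply/fixedFieldP; rewrite ?memvf.
by rewrite (galois_fixedField galL) => /vlineP.
Qed.
End IntegralClosure.

(** * One maximal ideal: inverses modulo it, its decomposition group, its contraction to [V] *)

Section MaxIdeals.
Variables (F : fieldType) (L : splittingFieldType F) (V : F -> Prop).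
Hypothesis hV : valuation_domain V.
Local Notation S := (int_closure (L := L) V).
Local Notation gT := (galT L).
Variable M : L -> Prop.
Hypothesis hM : max_ideal V M.

Lemma max_idealS x : M x -> S x. Proof. by case: hM => -[H _ _ _] _ _; apply: H. Qed.
Lemma max_ideal0 : M 0. Proof. by case: hM => -[]. Qed.
Lemma max_ideal1 : ~ M 1. Proof. by case: hM. Qed.
Lemma max_idealD x y : M x -> M y -> M (x + y).
Proof. by case: hM => -[_ _ H _] _ _; apply: H. Qed.
Lemma max_idealMl a x : S a -> M x -> M (a * x).
Proof. by case: hM => -[_ _ _ H] _ _; apply: H. Qed.
Lemma max_idealMr a x : M x -> S a -> M (x * a).
Proof. by rewrite mulrC => Mx Sa; apply: max_idealMl. Qed.
Lemma max_idealN x : M x -> M (- x).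
Proof. by move=> Mx; rewrite -mulN1r; apply: max_idealMl => //; apply/intSN/intS1. Qed.
Lemma max_idealB x y : M x -> M y -> M (x - y).
Proof. by move=> Mx /max_idealN; apply: max_idealD. Qed.
Lemma max_ideal_sum (I : Type) (r : seq I) (P : pred I) (E : I -> L) :
  (forall i, P i -> M (E i)) -> M (\sum_(i <- r | P i) E i).
Proof. by move=> ME; elim/big_ind: _ => //; [exact: max_ideal0 | exact: max_idealD]. Qed.
Lemma max_ideal_neq0 x : ~ M x -> x != 0.
Proof. by move=> Mx; apply/eqP => x0; apply: Mx; rewrite x0; apply: max_ideal0. Qed.
Lemma max_ideal_congr x y : M (x - y) -> M x <-> M y.
Proof.
move=> Mxy; split=> H; last by rewrite -(subrK y x); apply: max_idealD.
by rewrite -[y](subKr x); apply: max_idealB.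
Qed.

(** Maximality is applied to the ideal generated by [M] and [x]. *)
Lemma max_ideal_inv x : S x -> ~ M x -> exists2 y, S y & M (1 - y * x).
Proof.
move=> Sx Mx; case: hM => -[_ _ _ _] _ maxM.
have [||[m [s [Mm Ss E]]] | sub] := maxM (fun y => exists m s, [/\ M m, S s & y = m + s * x]).
- split.
  + by move=> y [m [s [/max_idealS Sm Ss ->]]]; apply/intSD/intSM.
  + by exists 0, 0; split; [exact: max_ideal0 | exact: intS0 | rewrite mul0r addr0].
  + move=> y z [m [s [Mm Ss ->]]] [n [t [Mn St ->]]]; exists (m + n), (s + t).
    by split; [exact: max_idealD | exact: intSD | rewrite mulrDl addrACA].
  + move=> a y Sa [m [s [Mm Ss ->]]]; exists (a * m), (a * s).
    by split; [exact: max_idealMl | exact: intSM | rewrite mulrDr mulrA].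
- by move=> y My; exists y, 0; split=> //; [exact: intS0 | rewrite mul0r addr0].
- by exists s => //; rewrite E addrK.
case: Mx; apply: sub; exists 0, 1; split; [exact: max_ideal0 | exact: intS1 |].
by rewrite add0r mul1r.
Qed.

Lemma max_ideal_prime x y : S x -> S y -> M (x * y) -> M x \/ M y.
Proof.
move=> Sx Sy Mxy; have [?|Mx] := pselect (M x); first by left.
right; have [z Sz Mz] := max_ideal_inv Sx Mx.
rewrite -[y]mul1r -(subrK (z * x) 1) mulrDl; apply: max_idealD; first exact: max_idealMr.
by rewrite -mulrA; apply: max_idealMl.
Qed.

Lemma max_ideal_Mn x y : S x -> S y -> ~ M x -> ~ M y -> ~ M (x * y).
Proof. by move=> Sx Sy Mx My /max_ideal_prime[]. Qed.

Lemma max_ideal_prodn (I : Type) (r : seq I) (P : pred I) (E : I -> L) :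
  (forall i, S (E i)) -> (forall i, P i -> ~ M (E i)) -> ~ M (\prod_(i <- r | P i) E i).
Proof.
move=> SE ME.
suff [] : S (\prod_(i <- r | P i) E i) /\ ~ M (\prod_(i <- r | P i) E i) by [].
elim/big_ind: _ => [|x y [Sx Mx] [Sy My]|i Pi]; first by split; [exact: intS1 | exact: max_ideal1].
  by split; [exact: intSM | exact: max_ideal_Mn].
by split; [exact: SE | exact: ME].
Qed.

Lemma max_ideal_prod1 (I : Type) (r : seq I) (P : pred I) (E : I -> L) :
  (forall i, P i -> S (E i)) -> (forall i, P i -> M (1 - E i)) ->
  M (1 - \prod_(i <- r | P i) E i).
Proof.
move=> SE ME.
suff [] : S (\prod_(i <- r | P i) E i) /\ M (1 - \prod_(i <- r | P i) E i) by [].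
elim/big_ind: _ => [|x y [Sx Mx] [Sy My]|i Pi].
- by split; [exact: intS1 | rewrite subrr; exact: max_ideal0].
- split; first exact: intSM.
  rewrite (_ : 1 - x * y = (1 - x) + x * (1 - y)); last by rewrite mulrBr mulr1 addrA subrK.
  by apply: max_idealD => //; apply: max_idealMl.
by split; [exact: SE | exact: ME].
Qed.

Lemma max_ideal_sub_eq (M' : L -> Prop) : max_ideal V M' -> (forall x, M' x -> M x) ->
  forall x, M' x <-> M x.
Proof.
move=> [_ _ maxM'] sub x; split; first exact: sub.
by case: hM => I1 M1 _; have [/M1 []|H Mx] := maxM' _ I1 sub; apply: H.
Qed.

Lemma max_ideal_conj (s : gT) : max_ideal V (fun x => M (s x)).
Proof.
have SK x : S (s x) -> S x.
  by move=> /(intS_gal s^-1%g); rewrite -galM_full mulgV gal_id.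
split.
- split.
  + by move=> x /max_idealS/SK.
  + by rewrite rmorph0; exact: max_ideal0.
  + by move=> x y Mx My; rewrite rmorphD; exact: max_idealD.
  + by move=> a x Sa Mx; rewrite rmorphM; apply: max_idealMl => //; apply: intS_gal.
- by rewrite rmorph1; exact: max_ideal1.
case: hM => _ _ maxM I [IS I0 ID IMl] sub.
have [| |I1|H] := maxM (fun x => I (s^-1%g x)).
- split.
  + by move=> x /IS/(intS_gal s); rewrite -galM_full mulVg gal_id.
  + by rewrite rmorph0.
  + by move=> x y Ix Iy; rewrite rmorphD; apply: ID.
  + by move=> a x Sa Ix; rewrite rmorphM; apply: IMl => //; apply: intS_gal.
- by move=> x Mx; apply: sub; rewrite -galM_full mulVg gal_id.
- by left; rewrite rmorph1 in I1.
by right=> x Ix; apply: H; rewrite -galM_full mulgV gal_id.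
Qed.

Lemma loc_intS x : S x -> loc V M x.
Proof. by move=> Sx; exists x, 1; split=> //; [exact: intS1|exact: max_ideal1|rewrite divr1]. Qed.

Lemma loc_max_intS x : loc_max V M x -> S x -> M x.
Proof.
move=> [a [b [Ma Sb Mb ->]]] Sab.
have : M (a / b * b) by rewrite divfK // max_ideal_neq0.
by case/max_ideal_prime.
Qed.

Lemma intS_loc_max x : M x -> loc_max V M x.
Proof. by move=> Mx; exists x, 1; split=> //; [exact: intS1|exact: max_ideal1|rewrite divr1]. Qed.

(** The definition of [GZ] speaks of the localization; this turns it into the stabilizer of [M]. If
    [s x] is in [M] and [x] is not, then [x^-1] is in the localization, and its image under [s]
    would be the inverse of an element of [M]. *)
Lemma GZP (s : gT) : reflect (forall x, M (s x) <-> M x) (s \in GZ V M).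
Proof.
rewrite inE; apply: (iffP (asboolP _)) => [sM|sM x [a [b [Sa Sb Mb ->]]]]; last first.
  exists (s a), (s b); split; [exact: intS_gal | exact: intS_gal | by rewrite sM|].
  by rewrite rmorphM fmorphV.
apply: max_ideal_sub_eq (max_ideal_conj s) _ => x Msx; apply: contrapT => Mx.
have Sx : S x by have [[H _ _ _] _ _] := max_ideal_conj s; apply: H.
have [a [b [Sa Sb Mb E]]] : loc V M (s x^-1).
  apply: sM; exists 1, x; split; [exact: intS1 | by [] | by [] |].
  by rewrite div1r.
apply: (Mb); have sx0 : s x != 0 by rewrite fmorph_eq0 max_ideal_neq0.
have -> : b = s x * a.
  have b0 := max_ideal_neq0 Mb; apply: (mulIf (invr_neq0 b0)).
  by rewrite mulfV // -mulrA -E fmorphV mulfV.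
exact: max_idealMr.
Qed.

Lemma GZ_group : group_set (GZ V M).
Proof.
apply/group_setP; split; first by apply/GZP => x; rewrite gal_id.
by move=> s t /GZP sM /GZP tM; apply/GZP => x; rewrite galM_full tM sM.
Qed.

Lemma nGZ (s : gT) : s \notin GZ V M -> exists2 a, S a & M (s a) /\ M (1 - a).
Proof.
move=> sM; have [x Mx nMx] : exists2 x, M (s x) & ~ M x.
  apply: contrapT => H; move/negP: sM; apply; apply/GZP.
  apply: max_ideal_sub_eq (max_ideal_conj s) _ => x Msx; apply: contrapT => Mx.
  by apply: H; exists x.
have Sx : S x by have [[H _ _ _] _ _] := max_ideal_conj s; apply: H.
have [y Sy Myx] := max_ideal_inv Sx nMx; exists (y * x); first exact: intSM.
by split=> //; rewrite rmorphM; apply: max_idealMl => //; apply: intS_gal.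
Qed.

(** A Chinese remainder element: the product, over [s] outside [GZ], of elements of s^-1 M that are
    1 modulo [M]. It is idempotent only modulo the conjugates of [M]. *)
Lemma max_ideal_idempotent : exists e, [/\ S e, M (1 - e) & forall s : gT, s \notin GZ V M -> M (s e)].
Proof.
have /choice[a aP] : forall s : gT, exists a, s \notin GZ V M -> [/\ S a, M (s a) & M (1 - a)].
  move=> s; have [sM|/negP sM] := pselect (s \in GZ V M); first by exists 0; rewrite sM.
  by have [a Sa [? ?]] := nGZ sM; exists a.
exists (\prod_(s | s \notin GZ V M) a s); split.
- by apply: intS_prod => // s /aP[].
- by apply: max_ideal_prod1 => s /aP[].
move=> s sM; rewrite rmorph_prod (bigD1 s) //=; apply: max_idealMr; first by have [] := aP s sM.
by apply: intS_prod => // t /andP[/aP[? _ _] _]; apply: intS_gal.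
Qed.

Lemma base_unit_notin_max c : V c -> ~ val_max V c -> ~ M c%:A.
Proof.
move=> Vc nc Mc; have [c0|c0] := eqVneq c 0; first by apply: nc; split=> //; left.
have [Vi|nVi] := pselect (V c^-1); last by apply: nc; split=> //; right.
apply: max_ideal1; have -> : 1 = c^-1%:A * c%:A :> L.
  by rewrite mulr_algl scalerA mulVf // scale1r.
by apply: max_idealMl => //; apply: intS_alg.
Qed.

Lemma max_ideal_val_max c : V c -> M c%:A -> val_max V c.
Proof. by move=> Vc Mc; apply: contrapT => /(base_unit_notin_max Vc). Qed.

(** [V] is local. With u = 1 - cd, either u/c or c/u is in [V]: the first would put 1/c = u/c + d in
    [V], the second 1/u = 1 + (c/u)d. *)
Lemma val_max_sub1 c d : val_max V c -> V d -> ~ val_max V (1 - c * d).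
Proof.
move=> [Vc cP] Vd [Vu uP].
have [c0|c0] := eqVneq c 0.
  rewrite c0 mul0r subr0 invr1 in uP; case: uP => [/eqP|]; first by rewrite oner_eq0.
  by apply; exact: vring1 hV.
have {cP}nVc : ~ V c^-1 by case: cP => // /eqP; rewrite (negPf c0).
have E : c^-1 = (1 - c * d) * c^-1 + d.
  by rewrite mulrBl mul1r mulrAC mulfV // mul1r subrK.
have [u0|u0] := eqVneq (1 - c * d) 0; first by apply: nVc; rewrite E u0 mul0r add0r.
have {uP}nVu : ~ V (1 - c * d)^-1 by case: uP => // /eqP; rewrite (negPf u0).
case: hV => _ _ _ _ /(_ ((1 - c * d) / c)); rewrite mulf_neq0 ?invr_neq0 // => /(_ isT).
case=> [H|]; first by apply: nVc; rewrite E; apply: vringD.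
rewrite invfM invrK mulrC => H; apply: nVu.
have -> : (1 - c * d)^-1 = 1 + c * (1 - c * d)^-1 * d.
  by apply: (mulIf u0); rewrite mulVf // mulrDl mul1r [X in _ + X]mulrAC divfK // subrK.
apply: (vringD hV); first exact: vring1.
by apply: (vringM hV).
Qed.

Hypothesis galL : galois 1%VS (fullv : {vspace L}).

(** Lying over: if c is not in [M], some 1 - yc is, and so is its norm. That norm has the form 1 -
    cd with d in [V], a unit of [V], which no element of [M] can be. *)
Lemma val_max_max_ideal c : val_max V c -> M c%:A.
Proof.
move=> mc; have [Vc cP] := mc; have [->|c0] := eqVneq c 0; first by rewrite scale0r; exact: max_ideal0.
apply: contrapT => nMc; have [y Sy My] := max_ideal_inv (intS_alg L hV Vc) nMc.
pose P := \prod_(s : gT) s (1 - y * c%:A).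
have MP : M P.
  rewrite /P (bigD1 1%g) //= gal_id; apply: max_idealMr => //; apply: intS_prod => // s _.
  by apply/intS_gal/intSB => //; [exact: intS1 | apply/intSM/intS_alg].
have [w Sw PE] : exists2 w, S w & P = 1 - c%:A * w.
  rewrite /P; elim/big_ind: _ => [|a b [u Su ->] [v Sv ->]|s _].
  - by exists 0; [exact: intS0 | rewrite mulr0 subr0].
  - exists (u + v - c%:A * (u * v)).
      by apply: intSB => //; [exact: intSD | apply: intSM; [|exact: intS_alg|exact: intSM]].
    by move: (c%:A : L) => z; ring.
  exists (s y); first exact: intS_gal.
  by rewrite rmorphB rmorphM rmorph1 /= rmorph_alg mulrC.
have cA0 : c%:A != 0 :> L by rewrite scaler_eq0 negb_or c0 oner_eq0.
(* The norm [P] is fixed by the Galois group, hence so are [c%:A * w] and [w]. *)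
have [d wE] : exists d : F, w = d%:A.
  apply: gal_fixed_base => // s; apply: (mulfI cA0).
  have sP : s P = P.
    rewrite /P rmorph_prod [RHS](reindex_inj (mulIg s)) /=.
    by apply: eq_bigr => t _; rewrite galM_full.
  have sPE : s P = 1 - c%:A * s w by rewrite PE rmorphB rmorphM rmorph1 /= rmorph_alg.
  by apply: oppr_inj; apply: (addrI 1); rewrite -sPE sP.
have Vd : V d by apply: (intS_base hV (L := L)); rewrite -wE.
have Mu : M (1 - c * d)%:A by rewrite scalerBl scale1r -scalerA -[c *: _]mulr_algl -wE -PE.
have Vu : V (1 - c * d) by apply: (vringB hV); [exact: vring1 | exact: vringM].
exact: base_unit_notin_max Vu (val_max_sub1 mc Vd) Mu.
Qed.

Lemma notin_max_base_unit c : V c -> ~ M c%:A -> c != 0 /\ V c^-1.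
Proof.
move=> Vc Mc; have c0 : c != 0.
  by apply: contra_not_neq Mc => ->; rewrite scale0r; apply: max_ideal0.
split=> //; apply: contrapT => nVc; apply: Mc; apply: val_max_max_ideal.
by split=> //; right.
Qed.
End MaxIdeals.

(** * Transitivity of the Galois group on maximal ideals *)

Section Conjugacy.
Variables (F : fieldType) (L : splittingFieldType F) (V : F -> Prop).
Hypothesis hV : valuation_domain V.
Hypothesis galL : galois 1%VS (fullv : {vspace L}).
Local Notation S := (int_closure (L := L) V).
Local Notation gT := (galT L).

(** Otherwise there is x in [M'] none of whose conjugates is in [M]. Its norm is in [V] and in [M'],
    so in the maximal ideal of [V] and in [M], against primality. *)
Lemma max_ideals_conjugate M M' : max_ideal V M -> max_ideal V M' ->
  exists s : gT, forall x, M' x <-> M (s x).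
Proof.
move=> hM hM'; apply: contrapT => nconj.
have /choice[a aP] : forall s : gT, exists a, M' a /\ M (s (1 - a)).
  move=> s; have [x M'x nMx] : exists2 x, M' x & ~ M (s x).
    apply: contrapT => H; apply: nconj; exists s.
    apply: (max_ideal_sub_eq (max_ideal_conj hM s) hM') => x M'x; apply: contrapT => Mx.
    by apply: H; exists x.
  have [y Sy Myx] := max_ideal_inv hV (max_ideal_conj hM s) (max_idealS hM' M'x) nMx.
  by exists (y * x); split=> //; apply: (max_idealMl hM').
(* Each [a s] is in [M'] and [s (a s)] is 1 modulo [M]; hence [x] is in [M'] and every [s x] is 1
   modulo [M]. *)
pose x := 1 - \prod_s (1 - a s).
have Sa s : S (1 - a s).
  by apply: intSB => //; [exact: intS1 | apply: (max_idealS hM'); case: (aP s)].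
have M'x : M' x.
  apply: (max_ideal_prod1 hV hM') => // s _; rewrite opprB addrCA subrr addr0.
  by case: (aP s).
have Mx (s : gT) : ~ M (s x).
  move=> Msx; apply: (max_ideal1 hM); rewrite -(subrK (s x) 1); apply: (max_idealD hM) => //.
  rewrite /x rmorphB rmorph1 opprB addrCA subrr addr0 rmorph_prod (bigD1 s) //=.
  apply: (max_idealMr hM); first by case: (aP s).
  by apply: intS_prod => // t _; apply: intS_gal.
pose P := \prod_(s : gT) s x.
have Sx : S x := max_idealS hM' M'x.
have [c Pc] : exists c, P = c%:A.
  apply: (gal_fixed_base galL) => s; rewrite /P rmorph_prod [RHS](reindex_inj (mulIg s)) /=.
  by apply: eq_bigr => t _; rewrite galM_full.
have M'P : M' P.
  rewrite /P (bigD1 1%g) //= gal_id; apply: (max_idealMr hM') => //.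
  by apply: intS_prod => // s _; apply: intS_gal.
have Vc : V c by apply: (intS_base hV (L := L)); rewrite -Pc; apply: (max_idealS hM').
have : M P.
  by rewrite Pc; apply: (val_max_max_ideal hV hM galL); apply: (max_ideal_val_max hV hM'); rewrite -?Pc.
by apply: (max_ideal_prodn hV hM) => [s|s _]; [apply: intS_gal | apply: Mx].
Qed.

(** [R] is [S] as a ring type and [k] is S/M: matrices and polynomials with entries in [S] are
    lifted along [i] and then reduced along [p]. *)
Lemma residue_ring M : max_ideal V M ->
  exists (R : comNzRingType) (i : {rmorphism R -> L}) (k : fieldType) (p : {rmorphism R -> k}),
  [/\ injective i, (forall x, S x <-> exists r, i r = x),
      (forall r, M (i r) <-> p r = 0) & (forall y, exists r, p r = y)].
Proof.
move=> hM; have [R [i [inj_i iS]]] := subring_type (intS1 L hV) (intSB hV) (intSM hV).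
have Si r : S (i r) by apply/iS; exists r.
have [||||y|k [p [pM p_surj]]] := @residue_field R (fun r => M (i r)).
- by rewrite rmorph0; exact: (max_ideal0 hM).
- by rewrite rmorph1; exact: (max_ideal1 hM).
- by move=> x y; rewrite rmorphD; exact: (max_idealD hM).
- by move=> a x; rewrite rmorphM => /(max_idealMl hM (Si a)).
- move=> /(max_ideal_inv hV hM (Si y))[z /iS[r <-] Mz]; exists r.
  by rewrite rmorphB rmorphM rmorph1.
by exists R, i, k, p.
Qed.

Lemma conj_morph (R : comNzRingType) (i : {rmorphism R -> L}) (s : gT) :
  injective i -> (forall x, S x <-> exists r, i r = x) ->
  exists h : {rmorphism R -> R}, forall r, i (h r) = s (i r).
Proof.
move=> inj_i iS; apply: (@rmorph_lift _ _ _ i (s \o i)) => // r.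
by apply/iS/intS_gal/iS; exists r.
Qed.
End Conjugacy.

(** * Tame ramification *)

Section Tame.
Variables (F : fieldType) (L : splittingFieldType F) (V : F -> Prop).
Hypothesis hV : valuation_domain V.
Hypothesis galL : galois 1%VS (fullv : {vspace L}).
Local Notation S := (int_closure (L := L) V).
Local Notation gT := (galT L).
Variable M : L -> Prop.
Hypothesis hM : max_ideal V M.

Lemma card_gal : #|[set: gT]| = \dim (fullv : {vspace L}).
Proof.
have := galois_dim galL; rewrite dimv1 divn1 => ->; apply: eq_card => s.
rewrite inE gal_kHom ?subvf //; apply/esym/kAHomP => x /vlineP[c ->].
by rewrite rmorph_alg.
Qed.

(** Orbit and stabilizer: [b] sends [s] to the index of the maximal ideal s^-1 M, and its fibres are
    cosets of [GZ]. *)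
Lemma card_GZ r : num_max_ideals L V r -> (#|GZ V M| * r)%N = \dim (fullv : {vspace L}).
Proof.
case=> Ms [Ms_max Ms_inj Ms_all]; rewrite -card_gal.
have /choice[a aP] : forall i, exists s : gT, forall x, Ms i x <-> M (s x).
  by move=> i; apply: max_ideals_conjugate hV galL _ _ hM (Ms_max i).
have /choice[b bP] : forall s : gT, exists i, forall x, M (s x) <-> Ms i x.
  by move=> s; apply: Ms_all (max_ideal_conj hM s).
pose GM := Group (GZ_group hV hM).
have fib i s : (b s == i) = (s \in (a i *: GM)%g).
  rewrite mem_lcoset; apply/eqP/(GZP hV hM) => [bs x|H].
    rewrite galM_full bP bs aP -galM_full mulVg gal_id.
    by [].
  apply: Ms_inj => x; rewrite -bP aP -{1}[s](mulKVg (a i)) galM_full H.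
  by [].
rewrite -[RHS]sum1_card (partition_big b predT) //=.
under eq_bigr => i _.
  rewrite (eq_bigl (fun s => s \in (a i *: GM)%g)); last by move=> s; rewrite in_setT fib.
  rewrite sum1_card card_lcoset; over.
by rewrite sum_nat_const card_ord mulnC.
Qed.

Lemma loc_maxD x y : loc_max V M x -> loc_max V M y -> loc_max V M (x + y).
Proof.
move=> [a [b [Ma Sb Mb ->]]] [c [d [Mc Sd Md ->]]].
exists (a * d + c * b), (b * d); split.
- by apply: (max_idealD hM); apply: (max_idealMr hM).
- exact: intSM.
- exact: (max_ideal_Mn hV hM).
by rewrite addf_div ?(max_ideal_neq0 hM).
Qed.

Lemma loc_maxMl x y : S x -> loc_max V M y -> loc_max V M (x * y).
Proof.
move=> Sx [a [b [Ma Sb Mb ->]]]; exists (x * a), b; split=> //; first exact: (max_idealMl hM).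
by rewrite mulrA.
Qed.

Lemma loc_max_sum (I : Type) (r : seq I) (P : pred I) (E : I -> L) :
  (forall i, P i -> loc_max V M (E i)) -> loc_max V M (\sum_(i <- r | P i) E i).
Proof.
move=> ME; elim/big_ind: _ => //; [exact/(intS_loc_max hV hM)/(max_ideal0 hM) | exact: loc_maxD].
Qed.

Lemma loc_residue x : loc V M x -> exists2 y, S y & loc_max V M (x - y).
Proof.
move=> [a [b [Sa Sb Mb ->]]]; have [c Sc Mcb] := max_ideal_inv hV hM Sb Mb.
exists (a * c); first exact: intSM.
exists (a * (1 - c * b)), b; split=> //; first exact: (max_idealMl hM).
have b0 := max_ideal_neq0 hM Mb.
by apply: (mulIf b0); rewrite mulrBl !divfK // mulrBr mulr1 mulrA.
Qed.

(** The basis is moved from the localization into [S], where the conditions can be read modulo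
    [M]. *)
Lemma res_degree_lift n : res_degree V M n -> exists w : 'I_n -> L,
  [/\ (forall i, S (w i)),
      (forall a : 'I_n -> F, (forall i, V (a i)) -> M (\sum_i (a i)%:A * w i) ->
         forall i, val_max V (a i)) &
      (forall y, S y -> exists a : 'I_n -> F, (forall i, V (a i)) /\
         M (y - \sum_i (a i)%:A * w i))].
Proof.
case=> xs [xs_loc xs_free xs_span].
have /choice[w wP] : forall i, exists y, S y /\ loc_max V M (xs i - y).
  by move=> i; have [y] := loc_residue (xs_loc i); exists y.
have diff (a : 'I_n -> F) : (forall i, V (a i)) ->
    loc_max V M (\sum_i (a i)%:A * xs i - \sum_i (a i)%:A * w i).
  move=> Va; rewrite -sumrB; apply: loc_max_sum => i _; rewrite -mulrBr.
  by apply: loc_maxMl; [exact: intS_alg | case: (wP i)].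
have Ssum (a : 'I_n -> F) : (forall i, V (a i)) -> S (\sum_i (a i)%:A * w i).
  move=> Va; apply: intS_sum => // i _; apply: intSM => //; first exact: intS_alg.
  by case: (wP i).
exists w; split=> [i|a Va Maw|y Sy]; first by case: (wP i).
  apply: xs_free => //; rewrite -(subrK (\sum_i (a i)%:A * w i) (\sum_i (a i)%:A * xs i)).
  by apply: loc_maxD; [exact: diff | exact: (intS_loc_max hV hM)].
have [a [Va ya]] := xs_span _ (loc_intS hV hM Sy); exists a; split=> //.
apply: (loc_max_intS hV hM); last by apply: intSB => //; apply: Ssum.
by have := loc_maxD ya (diff a Va); rewrite addrA subrK.
Qed.

Section Residue.
Variables (R : comNzRingType) (i : {rmorphism R -> L}) (k : fieldType) (p : {rmorphism R -> k}).
Hypothesis inj_i : injective i.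
Hypothesis iS : forall x, S x <-> exists r, i r = x.
Hypothesis pM : forall r, M (i r) <-> p r = 0.

(* The image in k = S/M of the residue field of V. *)
Definition base_res (z : k) : Prop := exists c r, [/\ V c, i r = c%:A & p r = z].

Lemma Si r : S (i r). Proof. by apply/iS; exists r. Qed.

Lemma base_res1 : base_res 1.
Proof. by exists 1, 1; split; [exact: vring1 | rewrite rmorph1 scale1r | rewrite rmorph1]. Qed.

Lemma base_resB x y : base_res x -> base_res y -> base_res (x - y).
Proof.
move=> [c [r [Vc rc <-]]] [d [s [Vd sd <-]]]; exists (c - d), (r - s).
by split; [exact: vringB | rewrite rmorphB rc sd scalerBl | rewrite rmorphB].
Qed.

Lemma base_res_div x y : base_res x -> base_res y -> base_res (x / y).
Proof.
move=> [c [r [Vc rc <-]]] [d [s [Vd sd <-]]].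
have [->|s0] := eqVneq (p s) 0.
  rewrite invr0 mulr0 -(subrr 1); exact: base_resB base_res1 base_res1.
have [d0 Vi] : d != 0 /\ V d^-1.
  by apply: (notin_max_base_unit hV hM galL) => //; rewrite -sd pM; apply/eqP.
have /iS[u ud] := intS_alg L hV Vi.
exists (c / d), (r * u); split; first exact: vringM.
  by rewrite rmorphM rc ud mulr_algl scalerA.
rewrite rmorphM; congr (_ * _); apply: (mulIf s0); rewrite mulVf // -rmorphM.
rewrite -(rmorph1 p); congr (p _); apply: inj_i.
by rewrite rmorphM ud sd mulr_algl scalerA mulVf // scale1r rmorph1.
Qed.

Hypothesis sepM : res_separable V M.
Variable h : gT -> {rmorphism R -> R}.
Hypothesis hi : forall s r, i (h s r) = s (i r).

(** Modulo [M], the conjugates of [b] are r over [GZ] and 0 elsewhere. The product of the X - s(b)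
    has coefficients in [V], and reduces to a power of X - p(r) times a power of X. Separability
    supplies a second polynomial over the residue field of [V], with p(r) as a simple root, and
    [simple_root_descent] applies. *)
Lemma fixed_residue r :
  (forall s, s \in GZ V M -> p (h s r) = p r) -> base_res (p r).
Proof.
move=> fix_r.
have [e [/iS[e' <-] Me eM]] := max_ideal_idempotent hV hM.
have pe : p e' = 1.
  apply/eqP; rewrite eq_sym -subr_eq0 -[X in X - _](rmorph1 p) -rmorphB.
  by apply/eqP/pM; rewrite rmorphB rmorph1.
pose b := r * e'.
have phe s : s \in GZ V M -> p (h s e') = 1.
  move=> sM; apply/eqP; rewrite eq_sym -subr_eq0 -[X in X - _](rmorph1 p) -rmorphB.
  apply/eqP/pM; rewrite rmorphB rmorph1 hi.
  have : M (s (1 - i e')) by have /(GZP hV hM) H := sM; apply/H.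
  by rewrite rmorphB rmorph1.
have phb s : p (h s b) = if s \in GZ V M then p r else 0.
  rewrite !rmorphM; case: ifPn => sM; first by rewrite phe // mulr1 fix_r.
  have -> : p (h s e') = 0 by apply/pM; rewrite hi; apply: eM.
  by rewrite mulr0.
pose Q := \prod_(s : gT) ('X - (h s b)%:P).
have mapQ : map_poly p Q = ('X - (p r)%:P) ^+ #|GZ V M| * 'X^#|~: GZ V M|.
  rewrite rmorph_prod /= (bigID (mem (GZ V M))) /=; congr (_ * _).
    rewrite (eq_bigr (fun=> 'X - (p r)%:P)) ?prodr_const // => s sM.
    by rewrite rmorphB /= map_polyX map_polyC /= phb sM.
  rewrite (eq_bigl (mem (~: GZ V M))) => [|s]; last by rewrite !inE.
  rewrite (eq_bigr (fun=> 'X)) ?prodr_const // => s.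
  move=> sM; have {}sM : s \notin GZ V M by rewrite -in_setC.
  rewrite rmorphB /= map_polyX map_polyC /= phb (negPf sM).
  by rewrite subr0.
have QK j : base_res (map_poly p Q)`_j.
  have [c Qc] : exists c, i Q`_j = c%:A.
    apply: (gal_fixed_base galL) => s; rewrite -hi.
    have Qs : map_poly (h s) Q = Q.
      rewrite {1}/Q rmorph_prod [RHS](reindex_inj (mulIg s)) /=.
      apply: eq_bigr => t _; rewrite rmorphB /= map_polyX map_polyC /=; congr (_ - _%:P).
      by apply: inj_i; rewrite !hi galM_full.
    by rewrite -[in RHS]Qs coef_map.
  exists c, Q`_j; split=> //; last by rewrite coef_map.
  by apply: (intS_base hV (L := L)); rewrite -Qc; apply: Si.
have [k0 [j jP]] := subfield_type base_res1 base_resB base_res_div.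
apply/jP.
have [q [q_mon Vq q0 q1]] := sepM (loc_intS hV hM (Si r)).
have [qR qRE] : exists qR, map_poly i qR = map_poly (in_alg L) q.
  by apply: poly_lift => l; apply/iS; rewrite coef_map; apply: intS_alg.
apply: (@simple_root_descent k0 k j (map_poly p qR) (p r) #|GZ V M|).
- move=> l; apply/jP; exists q`_l, qR`_l; split=> //; last by rewrite coef_map.
  by rewrite -coef_map /= qRE coef_map.
- by apply/card_gt0P; exists 1%g; apply: group1 (Group (GZ_group hV hM)).
(* Dropping the factor ['X^#|~: GZ V M|] shifts the coefficients. *)
- move=> l; apply/jP; have := QK (l + #|~: GZ V M|)%N.
  by rewrite mapQ coefMXn ltnNge leq_addl addnK.
- rewrite rootE horner_map; apply/eqP/pM; apply: (loc_max_intS hV hM); last exact: Si.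
  by rewrite -horner_map /= qRE.
rewrite deriv_map rootE horner_map.
apply/negP => /eqP/pM H; apply: q1; apply: (intS_loc_max hV hM).
by move: H; rewrite -horner_map /= -deriv_map qRE deriv_map.
Qed.
End Residue.

(** Comparing [card_GZ] with the defectless formula, the inertia order is [e], so some trace over
    [GZ] is nonzero modulo [M]. Multiplication by [eps] keeps that trace modulo [M] and puts the
    element in the other conjugates of [M]. *)
Theorem tame_trace e n r : res_degree V M n -> num_max_ideals L V r ->
  \dim (fullv : {vspace L}) = (e * n * r)%N -> ~ val_max V (e%:R : F) -> res_separable V M ->
  exists c, [/\ S c, forall s : gT, s \notin GZ V M -> M (s c) &
                ~ M (\sum_(s in GZ V M) s c)].
Proof.
move=> hn hr dimL e_unit sepM.
have [w [Sw w_free w_span]] := res_degree_lift hn.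
have [R [i [k [p [inj_i iS pM p_surj]]]]] := residue_ring hV hM.
have /choice[h hi] : forall s : gT, exists h : {rmorphism R -> R}, forall r, i (h r) = s (i r).
  by move=> s; apply: conj_morph inj_i iS.
have /choice[wR wE] : forall j, exists r, i r = w j by move=> j; apply/iS.
pose D := Group (GZ_group hV hM).
have [|||||||m [cardD mP]] := @inertia_index R k p gT h D (base_res i p) p_surj _ _ _ _ _ n wR.
- by move=> x; apply: inj_i; rewrite hi gal_id.
- by move=> a s x; apply: inj_i; rewrite !hi galM_full.
- by move=> s x /(GZP hV hM) sD /pM Mx; apply/pM; rewrite hi; apply/sD.
- by move=> x; apply: (fixed_residue inj_i iS pM sepM hi).
- move=> z [c [x [Vc xc xz]]]; exists x; split=> // s; apply: inj_i.
  by rewrite hi xc rmorph_alg.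
- move=> z /choice[c] /choice[x xP] zw j.
  have [Vc xc <-] := xP j; apply/pM; rewrite xc; apply: (val_max_max_ideal hV hM galL).
  apply: (w_free c) => [t|]; first by case: (xP t).
  suff -> : \sum_t (c t)%:A * w t = i (\sum_t x t * wR t).
    apply/pM; rewrite -[RHS]zw rmorph_sum; apply: eq_bigr => t _.
    by rewrite rmorphM; case: (xP t) => _ _ ->.
  rewrite rmorph_sum; apply: eq_bigr => t _.
  by rewrite rmorphM wE; case: (xP t) => _ -> _.
- move=> y; have [x <-] := p_surj y; have [a [Va xa]] := w_span _ (Si iS x).
  have /choice[b bP] : forall t, exists r, i r = (a t)%:A by move=> t; apply/iS/intS_alg.
  exists (fun t => p (b t)); split=> [t|]; first by exists (a t), (b t).
  apply/eqP; rewrite -subr_eq0.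
  have -> : p x - \sum_t p (b t) * p (wR t) = p (x - \sum_t b t * wR t).
    by rewrite rmorphB rmorph_sum; congr (_ - _); apply: eq_bigr => t _; rewrite rmorphM.
  apply/eqP/pM; rewrite rmorphB rmorph_sum.
  by under eq_bigr => t _ do rewrite rmorphM bP wE.
have me : m = e.
  have := card_GZ hr; rewrite dimL; rewrite -[GZ V M]/(D : {set gT}) cardD.
  have := cardG_gt0 D; rewrite cardD muln_gt0 => /andP[n0 m0].
  have r0 : (0 < r)%N by case: hr => Ms [_ _ /(_ _ hM)[j _]]; apply: leq_ltn_trans (ltn_ord j).
  by move/eqP; rewrite eqn_pmul2r // mulnC eqn_pmul2r // => /eqP.
have [c0 c0P] : exists r, \sum_(s in D) p (h s r) != 0.
  apply: mP; rewrite me; apply/eqP => e0; apply: (base_unit_notin_max hV hM (vring_nat hV e) e_unit).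
  by rewrite scaler_nat -(rmorph_nat i); apply/pM; rewrite rmorph_nat.
have [eps [Seps Meps epsM]] := max_ideal_idempotent hV hM.
exists (i c0 * eps); split=> [|s sM|].
- by apply: intSM => //; apply: Si.
- by rewrite rmorphM; apply: (max_idealMl hM); [apply/intS_gal/Si | apply: epsM].
move=> Mc; case/eqP: c0P; rewrite -rmorph_sum; apply/pM; rewrite rmorph_sum.
refine (proj1 (max_ideal_congr hV hM _) Mc); rewrite -sumrB; apply: (max_ideal_sum hM) => s sD.
rewrite hi rmorphM -[X in _ - X]mulr1 -mulrBr; apply: (max_idealMl hM); first exact/intS_gal/Si.
have : M (s (1 - eps)) by have /(GZP hV hM) H := sD; apply/H.
by move/(max_idealN hV hM); rewrite rmorphB rmorph1 opprB.
Qed.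
End Tame.

(** * The crossed product and its radical *)

Section CrossedProduct.
Variables (F : fieldType) (L : splittingFieldType F) (V : F -> Prop).
Hypothesis hV : valuation_domain V.
Local Notation S := (int_closure (L := L) V).
Local Notation gT := (galT L).
Variable f : gT -> gT -> L.
Hypothesis hf : normalized_2cocycle V f.
Local Notation afmul := (afmul f).
Local Notation Af := (Af (L := L) V).

Lemma cocycle_S s t : S (f s t). Proof. by case: hf => H _ _ _; case: (H s t). Qed.
Lemma cocycleE (s t g : gT) : s (f t g) * f s (pmul t g) = f s t * f (pmul s t) g.
Proof. by case: hf. Qed.
Lemma cocycle1l s : f 1%g s = 1. Proof. by case: hf. Qed.
Lemma cocycle1r s : f s 1%g = 1. Proof. by case: hf. Qed.
Lemma pmulE (s t : gT) x : pmul s t x = s (t x).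
Proof. exact: galM_full. Qed.
Lemma pmulA (s t u : gT) : pmul s (pmul t u) = pmul (pmul s t) u.
Proof. by rewrite /pmul mulgA. Qed.
Lemma pmulVK (s t : gT) : pmul s^-1%g (pmul s t) = t.
Proof. by rewrite /pmul mulgK. Qed.
Lemma pmulKV (s t : gT) : pmul s (pmul s^-1%g t) = t.
Proof. by rewrite /pmul mulgKV. Qed.
Lemma pmul_inv (s t : gT) : (pmul s t)^-1%g = pmul t^-1%g s^-1%g.
Proof. by rewrite /pmul invMg. Qed.
Lemma pmul1 (s : gT) : pmul s 1%g = s. Proof. by rewrite /pmul mul1g. Qed.
Lemma p1mul (s : gT) : pmul 1%g s = s. Proof. by rewrite /pmul mulg1. Qed.
Lemma pmulVg (s : gT) : pmul s^-1%g s = 1%g. Proof. by rewrite /pmul mulgV. Qed.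

(* The matrix of right multiplication by x in the left basis (x_t) of A_f. *)
Definition regrep (x : {ffun gT -> L}) (t u : gT) : L :=
  t (x (pmul t^-1%g u)) * f t (pmul t^-1%g u).

Lemma regrep1 x u : regrep x 1%g u = x u.
Proof. by rewrite /regrep gal_id invg1 p1mul cocycle1l mulr1. Qed.

Lemma regrep_inj x y : (forall t u, regrep x t u = regrep y t u) -> x = y.
Proof. by move=> E; apply/ffunP => u; rewrite -regrep1 E regrep1. Qed.

(** Here the cocycle identity enters: it makes right multiplications compose as matrices, and
    associativity of [afmul] follows. *)
Lemma regrepM x y t u : regrep (afmul x y) t u = \sum_v regrep x t v * regrep y v u.
Proof.
rewrite /regrep ffunE rmorph_sum mulr_suml (reindex_inj (mulIg t^-1%g)) /=.
apply: eq_bigr => v _; rewrite -[(v * t^-1)%g]/(pmul t^-1%g v).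
set s := pmul t^-1%g v; have -> : pmul t^-1%g u = pmul s (pmul v^-1%g u).
  by rewrite /s -pmulA pmulKV.
rewrite pmulVK !rmorphM /= -mulrA cocycleE -pmulE.
have -> : pmul t s = v by rewrite /s pmulKV.
by rewrite -!mulrA; congr (_ * _); rewrite mulrCA.
Qed.

Lemma regrepD x y t u : regrep (afadd x y) t u = regrep x t u + regrep y t u.
Proof. by rewrite /regrep ffunE rmorphD mulrDl. Qed.

Definition afscal (c : L) : {ffun gT -> L} := [ffun s => if s == 1%g then c else 0].

Lemma regrep_scal c t u : regrep (afscal c) t u = if t == u then t c else 0.
Proof.
rewrite /regrep ffunE /pmul -eq_mulgV1 eq_sym; case: eqP => [->|_]; last by rewrite rmorph0 mul0r.
by rewrite mulgV cocycle1r mulr1.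
Qed.

Lemma afmulA x y z : afmul x (afmul y z) = afmul (afmul x y) z.
Proof.
apply: regrep_inj => t u; rewrite !regrepM.
under eq_bigr do rewrite regrepM mulr_sumr.
rewrite exchange_big /=; apply: eq_bigr => v _.
by rewrite regrepM mulr_suml; apply: eq_bigr => w _; rewrite mulrA.
Qed.

Lemma afmulDr x y z : afmul x (afadd y z) = afadd (afmul x y) (afmul x z).
Proof.
apply: regrep_inj => t u; rewrite regrepD !regrepM -big_split /=.
by apply: eq_bigr => v _; rewrite regrepD mulrDr.
Qed.

Lemma afmulDl x y z : afmul (afadd x y) z = afadd (afmul x z) (afmul y z).
Proof.
apply: regrep_inj => t u; rewrite regrepD !regrepM -big_split /=.
by apply: eq_bigr => v _; rewrite regrepD mulrDl.
Qed.

Lemma afscal_mul c x s : afmul (afscal c) x s = c * x s.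
Proof.
rewrite -regrep1 regrepM (bigD1 1%g) //= regrep_scal eqxx gal_id regrep1 big1 ?addr0 //.
by move=> v v1; rewrite regrep_scal eq_sym (negPf v1) mul0r.
Qed.

Lemma afmul_scal c x s : afmul x (afscal c) s = x s * s c.
Proof.
rewrite -regrep1 regrepM (bigD1 s) //= regrep_scal eqxx regrep1 big1 ?addr0 //.
by move=> v vs; rewrite regrep_scal (negPf vs) mulr0.
Qed.

Lemma af1E : af1 L = afscal 1. Proof. by []. Qed.

Lemma af1mul x : afmul (af1 L) x = x.
Proof. by apply/ffunP => s; rewrite af1E afscal_mul mul1r. Qed.

Lemma afmul1 x : afmul x (af1 L) = x.
Proof. by apply/ffunP => s; rewrite af1E afmul_scal rmorph1 mulr1. Qed.

Lemma afmul0 x : afmul x (af0 L) = af0 L.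
Proof.
by apply/ffunP => s; rewrite !ffunE; apply: big1 => t _; rewrite ffunE rmorph0 mulr0 mul0r.
Qed.

Lemma af0mul x : afmul (af0 L) x = af0 L.
Proof. by apply/ffunP => s; rewrite !ffunE; apply: big1 => t _; rewrite ffunE !mul0r. Qed.

Lemma Af_mul x y : Af x -> Af y -> Af (afmul x y).
Proof.
move=> Sx Sy s; rewrite ffunE; apply: intS_sum => // t _.
apply: intSM => //; last exact: cocycle_S.
by apply: intSM => //; apply: intS_gal.
Qed.

Lemma Af_add x y : Af x -> Af y -> Af (afadd x y).
Proof. by move=> Sx Sy s; rewrite ffunE; apply: intSD. Qed.

Lemma Af_scal c : S c -> Af (afscal c).
Proof. by move=> Sc s; rewrite ffunE; case: ifP => // _; apply: intS0. Qed.

Lemma Af_regrep x t u : Af x -> S (regrep x t u).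
Proof. by move=> Sx; apply: intSM => //; [apply: intS_gal | apply: cocycle_S]. Qed.

(** Zorn's lemma on the left ideals that contain [g] but not 1, starting from the left ideal
    generated by [g]. *)
Lemma max_left_ideal_exists g : Af g ->
  ~ (exists2 b, Af b & afmul b g = af1 L) ->
  exists I, af_max_left_ideal V f I /\ I g.
Proof.
move=> Sg ninv.
pose Q (I : {ffun gT -> L} -> Prop) := [/\ af_left_ideal V f I, I g & ~ I (af1 L)].
pose T := {I | Q I}.
pose le (I J : T) : bool := `[< forall x, sval I x -> sval J x >].
have t0 : T.
  exists (fun x => exists2 b, Af b & afmul b g = x); split=> //; last first.
    by exists (af1 L); rewrite ?af1mul //; apply/Af_scal/intS1.
  split.
  - by move=> x [b Sb <-]; apply: Af_mul.
  - by exists (af0 L); [move=> s; rewrite ffunE; apply: intS0 | rewrite af0mul].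
  - move=> x y [b Sb <-] [c Sc <-]; exists (afadd b c); first exact: Af_add.
    by rewrite afmulDl.
  - move=> a x Sa [b Sb <-]; exists (afmul a b); first exact: Af_mul.
    by rewrite afmulA.
have [||A A_tot|I maxI] := @classical_sets.ZL_preorder T t0 le.
- by move=> I; apply/asboolP.
- by move=> J I K /asboolP IJ /asboolP JK; apply/asboolP => x /IJ/JK.
(* The empty chain is bounded by [t0], any other by its union. *)
- have [[I0 AI0]|nA] := pselect (exists I, A I); last first.
    by exists t0 => I AI; case: nA; exists I.
  have U : Q (fun x => exists2 I : T, A I & sval I x).
    split; last by move=> [I _]; have [] := svalP I.
      split.
      + by move=> x [I _]; have [[IS _ _ _] _ _] := svalP I; apply: IS.
      + by exists I0 => //; have [[]] := svalP I0.
      + move=> x y [I AI Ix] [J AJ Jy].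
        have [/asboolP IJ|/asboolP JI] := A_tot I J AI AJ.
          have [[_ _ JD _] _ _] := svalP J.
          by exists J => //; apply: JD => //; apply: IJ.
        have [[_ _ ID _] _ _] := svalP I.
        by exists I => //; apply: ID => //; apply: JI.
      + move=> a x Sa [I AI Ix]; exists I => //.
        by have [[_ _ _ IM] _ _] := svalP I; apply: IM.
    by exists I0 => //; have [] := svalP I0.
  by exists (exist Q _ U) => I AI; apply/asboolP => x Ix; exists I.
case: I maxI => I [IL Ig I1] maxI; exists I; split=> //; split=> // J JL IJ.
have [|J1] := pselect (J (af1 L)); [by left | right].
have PJ : Q J by split=> //; apply: IJ.
by have /asboolP := maxI (exist Q J PJ) (introT (asboolP _) IJ).
Qed.

(** Otherwise a maximal left ideal contains 1 + j; it also contains j, hence 1. *)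
Lemma jacobson_quasiregular j : jacobson V f j ->
  exists2 b, Af b & afmul b (afadd (af1 L) j) = af1 L.
Proof.
move=> [Sj jI]; apply: contrapT => ninv.
have Sg : Af (afadd (af1 L) j) by apply: Af_add => //; apply/Af_scal/intS1.
have [I [maxI Ig]] := max_left_ideal_exists Sg ninv.
have Ij := jI _ maxI; case: maxI => [[IS I0 ID IM] I1 _]; apply: I1.
have -> : af1 L = afadd (afadd (af1 L) j) (afmul (afscal (-1)) j).
  by apply/ffunP => s; rewrite [RHS]ffunE afscal_mul [X in _ = X + _]ffunE mulN1r addrK.
apply: ID => //; apply: IM => //; apply/Af_scal/intSN => //; exact: intS1.
Qed.
End CrossedProduct.

(** The size is a successor so that the matrices indexed by the group form a ring. *)
Lemma group_enum (gT : finGroupType) : exists n (en : 'I_n.+1 -> gT), bijective en.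
Proof.
have cG : #|gT| = #|gT|.-1.+1 by rewrite prednK //; apply/card_gt0P; exists 1%g.
exists #|gT|.-1, (fun i => enum_val (cast_ord (esym cG) i)).
exists (fun s => cast_ord cG (enum_rank s)) => x; first by rewrite enum_valK cast_ordKV.
by rewrite cast_ordK enum_rankK.
Qed.

(** * The radical modulo a maximal ideal, and the primary case *)

Section Primary.
Variables (F : fieldType) (L : splittingFieldType F) (V : F -> Prop).
Hypothesis hV : valuation_domain V.
Hypothesis galL : galois 1%VS (fullv : {vspace L}).
Local Notation S := (int_closure (L := L) V).
Local Notation gT := (galT L).
Variable f : gT -> gT -> L.
Hypothesis hf : normalized_2cocycle V f.
Local Notation afmul := (afmul f).
Local Notation Af := (Af (L := L) V).
Variable M : L -> Prop.
Hypothesis hM : max_ideal V M.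

Section Matrices.
Variables (n : nat) (en : 'I_n.+1 -> gT).
Hypothesis en_bij : bijective en.
Definition regmx (x : {ffun gT -> L}) : 'M[L]_n.+1 :=
  \matrix_(i, j) regrep f x (en i) (en j).

Lemma regmxM x y : regmx (afmul x y) = regmx x * regmx y.
Proof.
apply/matrixP => i j; rewrite !mxE (regrepM hf) (reindex en) /=; last exact: onW_bij.
by apply: eq_bigr => u _; rewrite !mxE.
Qed.

Lemma regmxD x y : regmx (afadd x y) = regmx x + regmx y.
Proof. by apply/matrixP => i j; rewrite !mxE regrepD. Qed.

Lemma regmx_base c : regmx (afscal c%:A) = (c%:A)%:M.
Proof.
apply/matrixP => i j; rewrite !mxE (regrep_scal hf) rmorph_alg (inj_eq (bij_inj en_bij)).
by case: eqP.
Qed.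

Lemma regmx1 : regmx (af1 L) = 1.
Proof. by rewrite af1E -(scale1r 1) regmx_base scale1r. Qed.

(** The diagonal entry at [t] is [t (x 1%g)], as [f t 1 = 1]. *)
Lemma regmx_trace x : \tr (regmx x) = \sum_(s : gT) s (x 1%g).
Proof.
rewrite (reindex en) /=; last exact: onW_bij.
by apply: eq_bigr => i _; rewrite mxE /regrep pmulVg (cocycle1r hf) mulr1.
Qed.

(** Elements of [V] are fixed by the group and act as scalar matrices, so q(x) can be computed in
    the matrix ring and still comes from an element of [Af]. *)
Lemma regmx_horner (x : {ffun gT -> L}) (q : {poly F}) : Af x -> (forall i, V q`_i) ->
  exists2 a, Af a & regmx a = horner_mx (regmx x) (map_poly (in_alg L) q).
Proof.
move=> Sx; elim/poly_ind: q => [|q c IH] Vq.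
  exists (afscal 0); first exact/Af_scal/intS0.
  by rewrite -(scale0r 1) regmx_base scale0r !rmorph0 /=; apply/matrixP => i j; rewrite !mxE ?mul0rn.
have Vq' i : V q`_i by have := Vq i.+1; rewrite coefD coefMX coefC /= addr0.
have Vc : V c by have := Vq 0; rewrite coefD coefMX coefC /= add0r.
have [a Sa aE] := IH Vq'; exists (afadd (afmul a x) (afscal c%:A)).
  by apply: Af_add => //; [apply: Af_mul | apply/Af_scal/intS_alg].
rewrite regmxD regmxM aE regmx_base rmorphD rmorphM /= map_polyX map_polyC /=.
by rewrite rmorphD rmorphM /= horner_mx_X horner_mx_C.
Qed.

(* Multiply the conjugates of the characteristic polynomial. *)
Lemma integral_annihilator x : Af x -> exists q : {poly F},
  [/\ q \is monic, (forall i, V q`_i) & horner_mx (regmx x) (map_poly (in_alg L) q) = 0].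
Proof.
move=> Sx; have [R [i [_ [_ [inj_i iS _ _]]]]] := residue_ring hV hM.
have /choice[h hi] : forall s : gT, exists h : {rmorphism R -> R}, forall r, i (h r) = s (i r).
  by move=> s; apply: conj_morph inj_i iS.
have /choice[e eE] : forall uv : 'I_n.+1 * 'I_n.+1, exists r, i r = regmx x uv.1 uv.2.
  by move=> [u v]; apply/iS; rewrite mxE; apply: Af_regrep.
pose A : 'M[R]_n.+1 := \matrix_(u, v) e (u, v).
have AE : map_mx i A = regmx x by apply/matrixP => u v; rewrite !mxE eE mxE.
pose Q := \prod_(s : gT) map_poly (h s) (char_poly A).
have Q_mon : Q \is monic.
  by apply: monic_prod => s _; apply: monic_map; apply: char_poly_monic.
have QA : horner_mx A Q = 0.
  rewrite /Q (bigD1 1%g) //= rmorphM /=.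
  have -> : map_poly (h 1%g) (char_poly A) = char_poly A.
    by apply: map_poly_id => c _; apply: inj_i; rewrite hi gal_id.
  by rewrite Cayley_Hamilton mul0r.
have Qfix j : exists c, V c /\ i Q`_j = c%:A.
  have [c Qc] : exists c, i Q`_j = c%:A.
    apply: (gal_fixed_base galL) => s; rewrite -hi.
    have Qs : map_poly (h s) Q = Q.
      rewrite {1}/Q rmorph_prod [RHS](reindex_inj (mulIg s)) /=.
      apply: eq_bigr => t _; rewrite -map_poly_comp; apply: eq_map_poly => y /=.
      by apply: inj_i; rewrite !hi galM_full.
    by rewrite -[in RHS]Qs coef_map.
  exists c; split=> //; apply: (intS_base hV (L := L)); rewrite -Qc.
  by apply/iS; exists Q`_j.
have [q qE] : exists q : {poly F}, map_poly (in_alg L) q = map_poly i Q.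
  apply: poly_lift => j; have [c [_ Qc]] := Qfix j; exists c.
  by rewrite coef_map /= Qc.
exists q; split.
- by rewrite -(map_monic (in_alg L)) qE monic_map.
- move=> j; have [c [Vc Qc]] := Qfix j; suff -> : q`_j = c by [].
  apply: (fmorph_inj (in_alg L)); rewrite /= -Qc.
  by have := congr1 (fun P : {poly L} => P`_j) qE; rewrite !coef_map.
by rewrite qE -AE -map_horner_mx QA map_mx0.
Qed.

(* If m is minimal with q_m a unit, then q = q_m X^m h modulo M with h(j) a unit,
   so j is nilpotent modulo M. *)
Lemma jacobson_trace j : af_left_ideal V f (jacobson V f) -> jacobson V f j ->
  M (\tr (regmx j)).
Proof.
move=> [_ _ _ JM] Jj; have Sj : Af j by case: Jj.
have [q [q_mon Vq qj]] := integral_annihilator Sj.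
have exm : exists m, `[< ~ M (q`_m)%:A >].
  exists (size q).-1; apply/asboolP; rewrite -lead_coefE (monicP q_mon) scale1r.
  exact: (max_ideal1 hM).
case: (ex_minnP exm) => m /asboolP Mqm m_min.
have [u0 Vu] := notin_max_base_unit hV hM galL (Vq m) Mqm.
(* [D] is the part of q from degree m on, divided by X^m and scaled to constant term 1; [q1] is (D -
   1)/X. So D(j) is 1 plus q1(j) j, which lies in the radical. *)
pose D := (q`_m)^-1 *: drop_poly m q; pose q1 := drop_poly 1 D.
have VD i : V D`_i by rewrite coefZ coef_drop_poly; apply: (vringM hV).
have [a Sa aE] := regmx_horner Sj (fun i => eq_ind_r V (VD (i + 1)%N) (coef_drop_poly 1 D i)).
have DE : D = 1 + q1 * 'X.
  rewrite -[LHS](poly_take_drop 1) expr1; congr (_ + _); apply/polyP => i.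
  rewrite coef_take_poly coef1; case: i => [|i] //=.
  by rewrite coefZ coef_drop_poly mulVf.
have [b Sb bE] := jacobson_quasiregular hV hf (JM a j Sa Jj).
set A := regmx j in qj aE *.
have {}bE : regmx b * horner_mx A (map_poly (in_alg L) D) = 1.
  rewrite DE rmorphD rmorphM /= rmorph1 map_polyX rmorphD rmorphM /= rmorph1 horner_mx_X.
  by rewrite -aE -regmxM -regmx1 -regmxD -regmxM bE.
(* [T] collects the coefficients below m, all in [M]; q(j) = 0 expresses [A ^+ m] through [T] once
   D(j) is cancelled by [b]. *)
pose T := map_poly (in_alg L) (take_poly m q).
have AmE : A ^+ m = - (q`_m)^-1%:A *: (regmx b * horner_mx A T).
  have : horner_mx A T + (q`_m)%:A *: horner_mx A (map_poly (in_alg L) D) * A ^+ m = 0.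
    rewrite -[RHS]qj -[in RHS](poly_take_drop m q) rmorphD rmorphM /= map_polyXn.
    rewrite rmorphD rmorphM /= rmorphXn /= horner_mx_X; congr (_ + _ * _).
    by rewrite -horner_mxZ /D map_polyZ /= scalerA mulr_algl scalerA mulfV // !scale1r.
  move/eqP; rewrite addrC addr_eq0 => /eqP E.
  rewrite -[LHS]mul1r -bE scaleNr -scalerN -mulrN -E.
  rewrite -scalerAl -scalerAr scalerA mulr_algl scalerA mulVf // !scale1r mulrA.
  by [].
have [R [i [k [p [inj_i iS pM p_surj]]]]] := residue_ring hV hM.
have lift x : Af x -> exists B : 'M[R]_n.+1, map_mx i B = regmx x.
  move=> Sx; have /choice[e eE] : forall uv : 'I_n.+1 * 'I_n.+1, exists r, i r = regmx x uv.1 uv.2.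
    by move=> [v w]; apply/iS; rewrite mxE; apply: Af_regrep.
  by exists (\matrix_(v, w) e (v, w)); apply/matrixP => v w; rewrite !mxE eE mxE.
have [B BE] := lift _ Sb; have [A' A'E] := lift _ Sj.
have /iS[v vE] := intS_alg L hV Vu.
have [T' T'E] : exists T', map_poly i T' = T.
  apply: poly_lift => l; apply/iS; rewrite coef_map; apply: intS_alg => //.
  by rewrite coef_take_poly; case: ifP => // _; apply: vring0.
have pT : map_poly p T' = 0.
  apply/polyP => l; rewrite coef_map coef0; apply/pM; rewrite -coef_map /= T'E coef_map /=.
  rewrite coef_take_poly; case: ltnP => [lm|_]; last by rewrite scale0r; apply: (max_ideal0 hM).
  apply: contrapT => Ml; have := m_min l (introT (asboolP _) Ml).
  by rewrite leqNgt lm.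
have A'm : A' ^+ m = - v *: (B * horner_mx A' T').
  have inj_mx (X Y : 'M[R]_n.+1) : map_mx i X = map_mx i Y -> X = Y.
    move=> /matrixP E; apply/matrixP => s t; apply: inj_i.
    by have := E s t; rewrite !mxE.
  apply: inj_mx; rewrite rmorphXn /= A'E AmE.
  by rewrite map_mxZ rmorphN vE map_mxM BE map_horner_mx A'E T'E.
have : (map_mx p A') ^+ m = 0.
  rewrite -rmorphXn A'm /= map_mxZ map_mxM map_horner_mx pT rmorph0 mulmx0 scaler0.
  by [].
move/nilpotent_trace; rewrite trace_map_mx => /pM.
by rewrite -trace_map_mx A'E.
Qed.
End Matrices.

(** If the coefficient had an inverse y modulo [M], the trace of c y j would be in [M]. Its terms
    outside [GZ] are in [M] because of c, and the others are congruent to s(c), so the excluded sum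
    would be in [M]. *)
Lemma jacobson_coef c j : S c -> (forall s : gT, s \notin GZ V M -> M (s c)) ->
  ~ M (\sum_(s in GZ V M) s c) ->
  af_left_ideal V f (jacobson V f) -> jacobson V f j -> M (j 1%g).
Proof.
move=> Sc cM Mc JL Jj; apply: contrapT => Mj.
have Sj : S (j 1%g) by case: Jj => /(_ 1%g).
have [y Sy Myj] := max_ideal_inv hV hM Sj Mj.
have [n [en en_bij]] := group_enum gT.
have Jx : jacobson V f (afmul (afscal (c * y)) j).
  by case: (JL) => _ _ _ JM; apply: JM => //; apply/Af_scal/intSM.
have := jacobson_trace en_bij JL Jx; rewrite regmx_trace // (afscal_mul hf).
rewrite (bigID (mem (GZ V M))) /= => H; apply: Mc.
have {}H : M (\sum_(s in GZ V M) s (c * y * j 1%g)).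
  rewrite -[X in M X](addrK (\sum_(s | s \notin GZ V M) s (c * y * j 1%g))).
  apply: (max_idealB hV hM) => //; apply: (max_ideal_sum hM) => s sM.
  rewrite -mulrA rmorphM; apply: (max_idealMr hM); first exact: cM.
  exact/intS_gal/intSM.
refine (proj2 (max_ideal_congr hV hM _) H); rewrite -sumrB; apply: (max_ideal_sum hM) => s sM.
rewrite -rmorphB -mulrA -[X in X - _]mulr1 -mulrBr rmorphM.
apply: (max_idealMl hM); first exact: intS_gal.
by have /(GZP hV hM) E := sM; apply/E.
Qed.

(* The largest ideal whose elements have their coefficient at 1 in M contains
   the radical, so equals it when A_f is primary; if the conclusion failed at s0
   it would also contain s0^-1(e), with e the idempotent modulo conjugates at M. *)
Lemma primary_representatives c (s0 : gT) : S c -> (forall s : gT, s \notin GZ V M -> M (s c)) ->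
  ~ M (\sum_(s in GZ V M) s c) -> Af_primary V f ->
  exists2 t, pmul t s0^-1%g \in GZ V M & ~ M (f t t^-1%g).
Proof.
move=> Sc cM Mc [[JL JR] J1 Jmax]; apply: contrapT => none.
pose I x := Af x /\ forall a b, Af a -> Af b -> M (afmul (afmul a x) b 1%g).
have S1 : Af (af1 L) by apply/Af_scal/intS1.
have IL : af_ideal V f I.
  split; last first.
    move=> c' x Sc' [Sx Ix]; split; first exact: Af_mul.
    move=> a b Sa Sb; rewrite (afmulA hf) -(afmulA hf); apply: Ix => //; exact: Af_mul.
  split.
  - by move=> x [].
  - split=> [s|a b _ _]; first by rewrite ffunE; apply: intS0.
    by rewrite afmul0 af0mul ffunE; apply: (max_ideal0 hM).
  - move=> x y [Sx Ix] [Sy Iy]; split; first exact: Af_add.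
    move=> a b Sa Sb; rewrite (afmulDr hf) (afmulDl hf) ffunE; apply: (max_idealD hM); [exact: Ix | exact: Iy].
  move=> c' x Sc' [Sx Ix]; split; first exact: Af_mul.
  move=> a b Sa Sb; rewrite (afmulA hf); apply: Ix => //; exact: Af_mul.
have JI x : jacobson V f x -> I x.
  move=> Jx; split=> [|a b Sa Sb]; first by case: Jx.
  by apply: (jacobson_coef Sc cM Mc JL); apply: JR => //; case: JL => _ _ _; apply.
have [[_ I1]|IJ] := Jmax _ IL JI.
  have := I1 _ _ S1 S1; rewrite !(afmul1 hf) ffunE eqxx; exact: (max_ideal1 hM).
have [e [Se Me eM]] := max_ideal_idempotent hV hM.
pose e' := (s0^-1%g : gT) e.
have Se' : S e' by apply: intS_gal.
have Ie : I (afscal e').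
  split; first exact: Af_scal.
  move=> a b Sa Sb; rewrite ffunE; apply: (max_ideal_sum hM) => s _.
  rewrite (afmul_scal hf) pmul1.
  (* When s s0^-1 is in [GZ], the assumption [none] puts f(s, s^-1) in [M]; otherwise s(e') = (s
     s0^-1)(e) is in [M]. *)
  have [sM|sM] := boolP (pmul s s0^-1%g \in GZ V M).
    apply: (max_idealMl hM); first by do 2?[apply: intSM => //]; apply: intS_gal => //; apply: intS_gal.
    by apply: contrapT => Mf; apply: none; exists s.
  rewrite /e' -pmulE; apply: (max_idealMr hM); last exact: cocycle_S.
  apply: (max_idealMr hM); last exact: intS_gal.
  by apply: (max_idealMl hM) => //; apply: eM.
(* So 1 - e' has a left inverse, although [s0] sends it to 1 - e, which is in [M]. *)
have Jx : jacobson V f (afmul (afscal (-1)) (afscal e')).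
  case: JL => _ _ _ JM; apply: JM; last exact: IJ.
  by apply/Af_scal/intSN => //; apply: intS1.
have [b Sb] := jacobson_quasiregular hV hf Jx.
move/(congr1 (fun x : {ffun gT -> L} => x 1%g)).
have -> : afadd (af1 L) (afmul (afscal (-1)) (afscal e')) = afscal (1 - e').
  apply/ffunP => s; rewrite ffunE (afscal_mul hf) !ffunE.
  by case: eqP => _; rewrite mulN1r ?oppr0 ?addr0.
rewrite (afmul_scal hf) ffunE eqxx gal_id => E.
apply: (max_ideal1 hM); rewrite -(rmorph1 s0) -E rmorphM; apply: (max_idealMl hM); first exact: intS_gal.
by rewrite rmorphB rmorph1 /= /e' -galM_full mulVg gal_id.
Qed.
End Primary.

(** * The graphs *)

Section PresentedGraphs.
Variables (I J T T' : finType) (D : {set I}) (D' : {set J}) (A : I -> T) (B : J -> T').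
Variables (R : I -> I -> Prop) (R' : J -> J -> Prop) (le : T -> T -> Prop) (le' : T' -> T' -> Prop).
Hypothesis leA : forall s t, s \in D -> t \in D -> le (A s) (A t) <-> R s t.
Hypothesis leB : forall s t, s \in D' -> t \in D' -> le' (B s) (B t) <-> R' s t.
Hypothesis eqA : forall s t, s \in D -> t \in D -> A s = A t <-> R s t /\ R t s.
Hypothesis eqB : forall s t, s \in D' -> t \in D' -> B s = B t <-> R' s t /\ R' t s.
Variable m : I -> J.
Hypothesis mD : forall s, s \in D -> m s \in D'.
Hypothesis mR : forall s t, s \in D -> t \in D -> R s t <-> R' (m s) (m t).

(** The vertices are presented by elements of preordered sets. A map that preserves and reflects the
    preorders induces an embedding, so only surjectivity up to equivalence is left to ask. *)
Lemma presented_graph_iso phi : (forall s, s \in D -> phi (A s) = B (m s)) ->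
  graph_iso (A @: D) le (B @: D') le' phi <->
  (forall u, u \in D' -> exists2 s, s \in D & R' (m s) u /\ R' u (m s)).
Proof.
move=> phiE; split=> [[[_ surj] _] u uD|surj].
  have [X /imsetP[s sD ->]] := surj _ (imset_f B uD).
  by rewrite phiE // => /(eqB (mD sD) uD); exists s.
split; [split; [split|] | split].
- by move=> X /imsetP[s sD ->]; rewrite phiE //; apply/imset_f/mD.
- move=> X Y /imsetP[s sD ->] /imsetP[t tD ->]; rewrite !phiE // leA // leB ?mD //.
  by rewrite -mR.
- move=> Y /imsetP[u uD ->]; have [s sD su] := surj _ uD.
  by exists (A s); [exact: imset_f | rewrite phiE //; apply/eqB => //; apply: mD].
- move=> X Y /imsetP[s sD ->] /imsetP[t tD ->]; rewrite !phiE // => /eqB; rewrite !mD //.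
  by move=> /(_ isT isT)[/mR st /mR ts]; apply/eqA => //; split; [apply: st | apply: ts].
move=> X Y /imsetP[s sD ->] /imsetP[t tD ->]; rewrite !phiE // leA // leB ?mD //.
by rewrite -mR.
Qed.

Lemma presented_graph_isomorphic s0 : s0 \in D ->
  (forall u, u \in D' -> exists2 s, s \in D & R' (m s) u /\ R' u (m s)) ->
  graph_isomorphic (A @: D) le (B @: D') le'.
Proof.
move=> s0D surj.
(* A vertex goes to the image of a chosen element presenting it; the default [s0] is never reached
   on a vertex. *)
exists (fun X => B (m (odflt s0 [pick s in D | A s == X]))); apply/presented_graph_iso => // s sD.
case: pickP => [t /andP[tD /eqP/eqA[//|//|st ts]] /=|/(_ s)]; last by rewrite sD eqxx.
by apply/eqB; rewrite ?mD // -!mR.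
Qed.
End PresentedGraphs.

(** * The graphs of a cocycle at one maximal ideal, then at two conjugate ones *)

Section CocycleGraphs.
Variables (F : fieldType) (L : splittingFieldType F) (V : F -> Prop).
Hypothesis hV : valuation_domain V.
Local Notation S := (int_closure (L := L) V).
Local Notation gT := (galT L).
Variable f : gT -> gT -> L.
Hypothesis hf : normalized_2cocycle V f.

Definition eqM (M : L -> Prop) (s t : gT) : Prop := leM f M s t /\ leM f M t s.

(* Surjectivity of psi_M. *)
Definition GZ_meets_classes (M : L -> Prop) : Prop :=
  forall s, exists2 d, d \in GZ V M & eqM M d s.

Section OneIdeal.
Variable M : L -> Prop.
Hypothesis hM : max_ideal V M.

Let Sf s t : S (f s t) := cocycle_S hf s t.

Lemma leM_refl s : leM f M s s.
Proof. by rewrite /leM pmulVg (cocycle1r hf); apply: (max_ideal1 hM). Qed.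

Lemma leM_trans s t u : leM f M s t -> leM f M t u -> leM f M s u.
Proof.
move=> st tu Msu; have := cocycleE hf s (pmul s^-1%g t) (pmul t^-1%g u).
rewrite pmulKV -pmulA pmulKV => E; apply: (max_ideal_Mn hV hM (Sf _ _) (Sf _ _) st tu).
by rewrite -E; apply: (max_idealMl hM) => //; apply/intS_gal/Sf.
Qed.

Lemma eqM_refl s : eqM M s s. Proof. by split; apply: leM_refl. Qed.
Lemma eqM_sym s t : eqM M s t -> eqM M t s. Proof. by case. Qed.
Lemma eqM_trans s t u : eqM M s t -> eqM M t u -> eqM M s u.
Proof. by move=> [? ?] [? ?]; split; apply: (@leM_trans _ t). Qed.

Lemma eqME s t : eqM M s t <-> ~ M (s (f (pmul s^-1%g t) (pmul t^-1%g s))).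
Proof.
have := cocycleE hf s (pmul s^-1%g t) (pmul t^-1%g s).
rewrite -[pmul (pmul _ _) _]pmulA !pmulKV pmulVg (cocycle1r hf) mulr1 => ->.
split=> [[st ts]|H]; first exact: (max_ideal_Mn hV hM).
by split=> Mx; apply: H; [apply: (max_idealMr hM) | apply: (max_idealMl hM)].
Qed.

Lemma eqM_GZ d s : d \in GZ V M -> eqM M d s <-> ~ M (f (pmul d^-1%g s) (pmul s^-1%g d)).
Proof. by move=> /(GZP hV hM) dM; rewrite eqME; split=> H /dM. Qed.

Lemma clsMP s t : reflect (eqM M s t) (t \in clsM f M s).
Proof. by rewrite inE; apply: asboolP. Qed.

Lemma eq_clsM s t : clsM f M s = clsM f M t <-> eqM M s t.
Proof.
split=> [E|st]; first by apply/clsMP; rewrite E; apply/clsMP/eqM_refl.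
apply/setP => u; apply/clsMP/clsMP; apply: eqM_trans => //; exact: eqM_sym.
Qed.

Lemma GrU_leE s t : GrU_le f M (clsM f M s) (clsM f M t) <-> leM f M s t.
Proof.
split=> [[u [v [/clsMP[su _] /clsMP[_ vt] uv]]]|st].
  exact: leM_trans su (leM_trans uv vt).
by exists s, t; split=> //; apply/clsMP/eqM_refl.
Qed.

Lemma GZ_pmul s t : s \in GZ V M -> t \in GZ V M -> pmul s t \in GZ V M.
Proof. by move=> sM tM; apply: (groupM (G := Group (GZ_group hV hM))). Qed.
Lemma GZ_inv s : s \in GZ V M -> s^-1%g \in GZ V M.
Proof. by move=> sM; rewrite (groupV (Group (GZ_group hV hM))). Qed.
Lemma GZ1 : 1%g \in GZ V M.
Proof. exact: (group1 (Group (GZ_group hV hM))). Qed.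

(** For d and t in [GZ], t is equivalent to d exactly when d^-1 t is in [HM]. This is why [psi] is
    an embedding. *)
Lemma lcos_HME d : d \in GZ V M -> lcos (HM V f M) d = clsM f M d :&: GZ V M.
Proof.
move=> dM; apply/setP => t; rewrite [RHS]in_setI; apply/imsetP/andP => [[h]|[/clsMP dt tM]].
  rewrite inE => /andP[hM' /asboolP Mh] ->; split; last exact: GZ_pmul.
  by apply/clsMP/eqM_GZ; rewrite // pmulVK pmul_inv -pmulA pmulVg pmul1.
exists (pmul d^-1%g t); last by rewrite pmulKV.
rewrite inE GZ_pmul ?GZ_inv //=; apply/asboolP.
by rewrite pmul_inv invgK; apply/eqM_GZ.
Qed.

Lemma eq_lcos_HM d d' : d \in GZ V M -> d' \in GZ V M ->
  lcos (HM V f M) d = lcos (HM V f M) d' <-> eqM M d d'.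
Proof.
move=> dM d'M; rewrite !lcos_HME //; split=> [E|/eq_clsM -> //].
have : d' \in clsM f M d :&: GZ V M by rewrite E in_setI d'M andbT; apply/clsMP/eqM_refl.
by rewrite in_setI => /andP[/clsMP].
Qed.

Lemma GrL_leE d d' : d \in GZ V M -> d' \in GZ V M ->
  GrL_le V f M (lcos (HM V f M) d) (lcos (HM V f M) d') <-> leM f M d d'.
Proof.
move=> dM d'M; rewrite !lcos_HME //; split=> [[u [v []]]|dd'].
  rewrite !in_setI => /andP[/clsMP[du _] _] /andP[/clsMP[_ vd] _] _ _ uv.
  exact: leM_trans du (leM_trans uv vd).
by exists d, d'; split=> //; rewrite in_setI ?dM ?d'M andbT; apply/clsMP/eqM_refl.
Qed.

Lemma psi_lcos d : d \in GZ V M -> psi f M (lcos (HM V f M) d) = clsM f M d.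
Proof.
move=> dM; apply/eq_clsM/eqM_sym/clsMP.
have : d \in clsM f M d :&: GZ V M by rewrite in_setI dM andbT; apply/clsMP/eqM_refl.
by rewrite lcos_HME // => /mem_repr; rewrite in_setI => /andP[].
Qed.

Lemma psi_is_isoE : psi_is_iso V f M <-> GZ_meets_classes M.
Proof.
rewrite /psi_is_iso /GrL_vs /GrU_vs.
have -> := @presented_graph_iso _ _ _ _ (GZ V M) [set: gT] (lcos (HM V f M)) (clsM f M)
  (leM f M) (leM f M) _ _ _ (fun s t _ _ => GrU_leE s t) _ _ id _ _ (psi f M) _.
- by split=> H u; [have [//|d] := H u; exists d | move=> _; have [d] := H u; exists d].
- exact: GrL_leE.
- exact: eq_lcos_HM.
- by move=> s t _ _; apply: eq_clsM.
- by [].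
- by [].
- exact: psi_lcos.
Qed.

Lemma GZ_meets_classesE : GZ_meets_classes M <->
  forall s, exists2 t, pmul t s^-1%g \in GZ V M & ~ M (f t t^-1%g).
Proof.
split=> H s; have [d dM ds] := H s.
  exists (pmul d^-1%g s); first by rewrite -pmulA /pmul mulVg mul1g; apply: GZ_inv.
  by rewrite pmul_inv invgK; apply/eqM_GZ.
exists (pmul s d^-1%g); first by rewrite -[s]invgK -pmul_inv; apply: GZ_inv.
apply/eqM_GZ; first by rewrite -[s]invgK -pmul_inv; apply: GZ_inv.
by rewrite pmul_inv invgK -pmulA pmulVg pmul1 pmulVK.
Qed.

Lemma rcos_GZE s : rcos (GZ V M) s = (s *: Group (GZ_group hV hM))%g.
Proof. by apply/setP => t; apply/imsetP/lcosetP => -[h hM' ->]; exists h. Qed.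

Lemma transversalE :
  (exists T : {set gT}, rcos_transversal V M T /\ (forall s, s \in T -> ~ M (f s s^-1%g))) <->
  (forall s, exists2 t, pmul t s^-1%g \in GZ V M & ~ M (f t t^-1%g)).
Proof.
have rcosP s t : (t \in rcos (GZ V M) s) = (pmul t s^-1%g \in GZ V M).
  by rewrite rcos_GZE mem_lcoset.
have eq_rcos s t : t \in rcos (GZ V M) s -> rcos (GZ V M) t = rcos (GZ V M) s.
  by rewrite !rcos_GZE => /lcoset_eqP.
split=> [[T [T1 TM]] s|H].
  have /eqP/cards1P[t E] := T1 s.
  have : t \in rcos (GZ V M) s :&: T by rewrite E set11.
  by rewrite inE => /andP[ts /TM Mt]; exists t; rewrite -?rcosP.
(* The choice depends on the coset as a set, so that equal cosets share one representative; 1 is a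
   dummy value off the cosets. *)
have /choice[g gP] : forall C : {set gT}, exists t, forall s, C = rcos (GZ V M) s ->
    t \in C /\ ~ M (f t t^-1%g).
  move=> C; have [[s ->]|nC] := pselect (exists s, C = rcos (GZ V M) s); last first.
    by exists 1%g => s Cs; case: nC; exists s.
  by have [t ts Mt] := H s; exists t => _ _; rewrite rcosP.
exists [set g (rcos (GZ V M) s) | s in [set: gT]]; split=> [s|_ /imsetP[s _ ->]]; last first.
  by case: (gP _ s erefl).
apply/eqP/cards1P; exists (g (rcos (GZ V M) s)); apply/setP => t; rewrite !inE.
apply/andP/eqP => [[ts /imsetP[s' _ tE]]|->].
  have ts' : t \in rcos (GZ V M) s' by rewrite tE; case: (gP _ s' erefl).
  by rewrite -(eq_rcos _ _ ts) (eq_rcos _ _ ts').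
by split; [case: (gP _ s erefl) | apply: imset_f].
Qed.

Lemma unitS_notin_max x : unitS V x -> ~ M x.
Proof.
move=> [Sx x0 Si] Mx; apply: (max_ideal1 hM); rewrite -(mulVf x0).
exact: (max_idealMl hM).
Qed.

(** Units of [S] avoid every maximal ideal, so the cosets of [Hf] refine the classes of [M]. *)
Lemma lcos_Hf_eqM s t : t \in lcos (Hf V f) s -> eqM M s t.
Proof.
case/imsetP => h; rewrite inE => /asboolP[Sh h0 Sih] ->; apply/eqME.
rewrite pmulVK pmul_inv -pmulA pmulVg pmul1; apply: unitS_notin_max; split.
- exact: intS_gal.
- by rewrite fmorph_eq0.
by rewrite -fmorphV; apply: intS_gal.
Qed.

Lemma lcos_Hf_self s : s \in lcos (Hf V f) s.
Proof.
apply/imsetP; exists 1%g; last by rewrite pmul1.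
rewrite inE invg1 (cocycle1r hf); apply/asboolP; split; rewrite ?oner_eq0 ?invr1 //; exact: intS1.
Qed.

Lemma lcos_Hf_repr s : eqM M s (repr (lcos (Hf V f) s)).
Proof. exact/lcos_Hf_eqM/(mem_repr s)/lcos_Hf_self. Qed.

(** [phi] is defined without choosing d: the class of the coset is cut down to [GZ], and by
    [lcos_HME] this is the coset of any admissible d. *)
Lemma phi_exists : GZ_meets_classes M -> phi_good V f M.
Proof.
move=> P; pose phi (X : {set gT}) := clsM f M (repr X) :&: GZ V M.
have phiE s d : d \in GZ V M -> eqM M d s -> phi (lcos (Hf V f) s) = lcos (HM V f M) d.
  move=> dM ds; rewrite lcos_HME // /phi; congr (_ :&: _); apply/eq_clsM/eqM_sym.
  exact: eqM_trans ds (lcos_Hf_repr s).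
exists phi; split.
- split=> [s|s d dM /(eqM_GZ _ dM)]; last exact: phiE.
  by have [d dM /(eqM_GZ _ dM) ds] := P s; exists d.
- split; [split|].
  + move=> X /imsetP[s _ ->]; have [d dM ds] := P s.
    by rewrite (phiE _ _ dM ds); apply: imset_f.
  + move=> X Y /imsetP[s _ ->] /imsetP[t _ ->] [u [v [su tv /unitS_notin_max uv]]].
    have [d dM [ds sd]] := P s; have [d' d'M [d't td']] := P t.
    rewrite (phiE _ _ dM) // (phiE _ _ d'M) //; apply/GrL_leE => //.
    have [su' _] := lcos_Hf_eqM su; have [_ vt] := lcos_Hf_eqM tv.
    exact: leM_trans ds (leM_trans su' (leM_trans uv (leM_trans vt td'))).
  move=> Y /imsetP[d dM ->]; exists (lcos (Hf V f) d); first exact: imset_f.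
  exact/phiE/eqM_refl.
move=> X /imsetP[s _ ->]; have [d dM ds] := P s; rewrite (phiE _ _ dM ds) psi_lcos //.
by apply/eq_clsM; apply: eqM_trans ds (lcos_Hf_repr s).
Qed.
End OneIdeal.

Section TwoIdeals.
Variables (M N : L -> Prop) (g : gT).
Hypotheses (hM : max_ideal V M) (hN : max_ideal V N).
Hypothesis MN : forall x, M x <-> N (g x).
Hypothesis Ng : ~ N (f g g^-1%g).

(* f g t divides f g g^-1, so it is not in N. *)
Lemma leM_conj s t : leM f M s t <-> leM f N (pmul g s) (pmul g t).
Proof.
have nN u : ~ N (f g u).
  move=> Nu; apply: Ng; have := cocycleE hf g g^-1%g (pmul g u).
  rewrite pmulVK [pmul g g^-1%g]/pmul mulVg (cocycle1l hf) mulr1 => <-.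
  by apply: (max_idealMl hN) => //; apply/intS_gal/(cocycle_S hf).
have := cocycleE hf g s (pmul s^-1%g t); rewrite pmulKV => E.
rewrite /leM pmul_inv -[pmul (pmul _ _) _]pmulA pmulVK MN; split=> H Nx; apply: H.
  have : N (g (f s (pmul s^-1%g t)) * f g t) by rewrite E; apply: (max_idealMl hN) => //; apply: (cocycle_S hf).
  case/(max_ideal_prime hV hN) => [|//|//|/nN //]; last exact: (cocycle_S hf).
  exact/intS_gal/(cocycle_S hf).
have : N (f g s * f (pmul g s) (pmul s^-1%g t)).
  by rewrite -E; apply: (max_idealMr hN) => //; apply: (cocycle_S hf).
by case/(max_ideal_prime hV hN) => [| |/nN //|//]; apply: (cocycle_S hf).
Qed.

(** If z in [GZ V N] is equivalent to g s, so is z g, as f(g, g^-1) is not in [N]. Now z g = g (g^-1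
    z g), where g^-1 z g stabilizes [M], and [leM_conj] carries the equivalence back to s. *)
Lemma GZ_meets_classes_conj : GZ_meets_classes N -> GZ_meets_classes M.
Proof.
move=> P s; have [z zN [zs sz]] := P (pmul g s).
have [zg gz] : eqM N (pmul z g) z.
  by apply: eqM_sym; apply/(eqM_GZ hN _ zN); rewrite pmulVK pmul_inv -pmulA pmulVg pmul1.
have E : pmul g (pmul (pmul g^-1%g z) g) = pmul z g by rewrite !pmulA [pmul g g^-1%g]/pmul mulVg p1mul.
exists (pmul (pmul g^-1%g z) g).
  apply/(GZP hV hM) => x; rewrite !MN -pmulE E pmulE.
  by have /(GZP hV hN) := zN.
split; apply/leM_conj; rewrite E.
  exact: (leM_trans hN zg zs).
exact: (leM_trans hN sz gz).
Qed.

Hypothesis P : GZ_meets_classes N.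

Lemma GrU_conj : GrU_isomorphic f M N.
Proof.
apply: (@presented_graph_isomorphic _ _ _ _ setT setT _ _ (leM f M) (leM f N) _ _ _ _ _ _ (pmul g) _ _ 1%g).
- by move=> s t _ _; apply: GrU_leE.
- by move=> s t _ _; apply: GrU_leE.
- by move=> s t _ _; apply: eq_clsM.
- by move=> s t _ _; apply: eq_clsM.
- by move=> s _; rewrite inE.
- by move=> s t _ _; apply: leM_conj.
- by rewrite inE.
by move=> u _; exists (pmul g^-1%g u); rewrite ?inE // pmulKV; apply: eqM_refl.
Qed.

Lemma GrLU_conj : GrLU_isomorphic V f M N.
Proof.
apply: (@presented_graph_isomorphic _ _ _ _ (GZ V M) setT _ _ (leM f M) (leM f N) _ _ _ _ _ _ (pmul g) _ _ 1%g).
- exact: GrL_leE.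
- by move=> s t _ _; apply: GrU_leE.
- exact: eq_lcos_HM.
- by move=> s t _ _; apply: eq_clsM.
- by move=> s _; rewrite inE.
- by move=> s t _ _; apply: leM_conj.
- exact: GZ1.
move=> u _; have [d dM [ds sd]] := GZ_meets_classes_conj P (pmul g^-1%g u).
by exists d => //; rewrite -{1}[u](pmulKV g) -{2}[u](pmulKV g); split; apply/leM_conj.
Qed.

(** Left multiplication by g need not map [GZ V M] into [GZ V N], so g s is replaced by an
    equivalent element of [GZ V N]. *)
Lemma GrL_conj : GrL_isomorphic V f M N.
Proof.
have /choice[m mP] : forall s, exists d, d \in GZ V N /\ eqM N d (pmul g s).
  by move=> s; have [d] := P (pmul g s); exists d.
apply: (@presented_graph_isomorphic _ _ _ _ (GZ V M) (GZ V N) _ _ (leM f M) (leM f N) _ _ _ _ _ _ m _ _ 1%g).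
- exact: GrL_leE.
- exact: GrL_leE.
- exact: eq_lcos_HM.
- exact: eq_lcos_HM.
- by move=> s _; case: (mP s).
- move=> s t _ _; rewrite leM_conj; have [_ [s1 s2]] := mP s; have [_ [t1 t2]] := mP t.
  split=> H; first exact: (leM_trans hN s1 (leM_trans hN H t2)).
  exact: (leM_trans hN s2 (leM_trans hN H t1)).
- exact: GZ1.
move=> u _; have [d dM [ds sd]] := GZ_meets_classes_conj P (pmul g^-1%g u).
exists d => //; apply: (eqM_trans hN (proj2 (mP d))).
by rewrite -[u](pmulKV g); split; apply/leM_conj.
Qed.
End TwoIdeals.
End CocycleGraphs.

(** * From one maximal ideal to all of them, and the theorem *)

Section Main.
Variables (F : fieldType) (L : splittingFieldType F) (V : F -> Prop).
Hypothesis hV : valuation_domain V.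
Hypothesis galL : galois 1%VS (fullv : {vspace L}).
Variable f : galT L -> galT L -> L.
Hypothesis hf : normalized_2cocycle V f.

(** Every element of the right coset of [GZ V N] through a conjugating s also carries [M] to [N];
    the coset criterion provides one with f(t, t^-1) outside [N]. *)
Lemma conj_representative M N : max_ideal V M -> max_ideal V N ->
  GZ_meets_classes V f N -> exists g : galT L, (forall x, M x <-> N (g x)) /\ ~ N (f g g^-1%g).
Proof.
move=> hM hN /(GZ_meets_classesE hV hf hN) Q.
have [s sP] := max_ideals_conjugate hV galL hN hM; have [t /(GZP hV hN) ts Nt] := Q s.
exists t; split=> // x; rewrite sP.
by have := ts (s x); rewrite -pmulE /pmul mulKVg => ->.
Qed.

Lemma tame_primary_meets_classes : tame_defectless L V -> Af_primary V f ->
  exists2 M, max_ideal V M & GZ_meets_classes V f M.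
Proof.
move=> [M [hM [e [n [r [_ hn hr dimL [e_unit sepM]]]]]]] prim; exists M => //.
have [c [Sc cM Mc]] := tame_trace hV galL hM hn hr dimL e_unit sepM.
apply/(GZ_meets_classesE hV hf hM) => s.
exact: (primary_representatives hV galL hf hM s Sc cM Mc prim).
Qed.
End Main.

Theorem theorem5p1 (F : fieldType) (L : splittingFieldType F) (V : F -> Prop)
    (f : galT L -> galT L -> L) (N : L -> Prop) :
  valuation_domain V ->
  galois 1%VS (fullv : {vspace L}) ->
  normalized_2cocycle V f ->
  max_ideal V N ->
  [/\
   (* (1) *)
   (psi_is_iso V f N <->
      exists T : {set galT L}, rcos_transversal V N T /\
                               (forall s, s \in T -> ~ N (f s s^-1%g))),
   (psi_is_iso V f N -> phi_good V f N),
   (* (2) *)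
   (psi_is_iso V f N -> forall M, max_ideal V M ->
      [/\ GrU_isomorphic f M N, GrLU_isomorphic V f M N,
          GrLU_isomorphic V f N N & psi_is_iso V f M]) &
   (* in particular *)
   (tame_defectless L V -> Af_primary V f ->
      [/\ psi_is_iso V f N, phi_good V f N &
          forall M M', max_ideal V M -> max_ideal V M' ->
            [/\ GrU_isomorphic f M M', GrL_isomorphic V f M M' &
                GrLU_isomorphic V f M M']])].
Proof.
move=> hV galL hf hN.
have isoE M (hM : max_ideal V M) := psi_is_isoE hV hf hM.
have conj M M' (hM : max_ideal V M) (hM' : max_ideal V M') := conj_representative hV galL hf hM hM'.
split.
- by rewrite isoE // (transversalE hV f hN); apply: GZ_meets_classesE.
- by rewrite isoE //; apply: phi_exists.
- rewrite isoE // => P M hM; have [g [MN Ng]] := conj _ _ hM hN P.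
  (* The case M = N of the conjugation lemmas compares Gr(f_N) with Gr(f^N). *)
  have [g' [NN Ng']] := conj _ _ hN hN P.
  split; [exact: (GrU_conj hV hf hM hN MN Ng)|exact: (GrLU_conj hV hf hM hN MN Ng)|
    exact: (GrLU_conj hV hf hN hN NN Ng')|].
  by rewrite isoE //; apply: (GZ_meets_classes_conj hV hf hM hN MN Ng).
move=> tame prim; have [M0 hM0 P0] := tame_primary_meets_classes hV galL hf tame prim.
(* Tameness and primarity give the property at one maximal ideal; conjugation spreads it to all. *)
have P M : max_ideal V M -> GZ_meets_classes V f M.
  move=> hM; have [g [MM0 M0g]] := conj _ _ hM hM0 P0.
  exact: (GZ_meets_classes_conj hV hf hM hM0 MM0 M0g).
split; [by rewrite isoE //; apply: P | by apply: phi_exists => //; apply: P |].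
move=> M M' hM hM'; have [g [MM' M'g]] := conj _ _ hM hM' (P _ hM').
split; [exact: (GrU_conj hV hf hM hM' MM' M'g) | exact: (GrL_conj hV hf hM hM' MM' M'g (P _ hM')) |
  exact: (GrLU_conj hV hf hM hM' MM' M'g (P _ hM'))].
Qed.
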